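(* Let $\Pi$ be an $\mathsf{MLL1^X}$ proof of a rectified sequent $\vdash\Gamma$ in which $\mathsf f$ does not occur. Then the linked fograph $\mathcal F(\Pi)=\langle\mathcal G(\Gamma),\sim_\Pi\rangle$ is a fonet, and $\delta_\Pi$ is a dualizer for it.
   Context: Formulas: terms $t::=x\mid f(t_1,\dots,t_n)$; atoms $a::=\mathsf t\mid\mathsf f\mid p(\vec t)\mid\bar p(\vec t)$ (each predicate $p$ has a dual $\bar p$, $\bar{\bar p}=p$); formulas $A::=a\mid A\wedge A\mid A\vee A\mid\exists x.A\mid\forall x.A$, with $\overline{p(\vec t)}=\bar p(\vec t)$, $\bar{\mathsf t}=\mathsf f$. A sequent is a finite multiset of formulas, with $\bigvee\Gamma$ the disjunction of its members; it is rectified if $\bigvee\Gamma$ is, i.e., all bound variables are distinct from each other and from free variables. $\mathsf{MLL1^X}$ has rules: $\mathsf{ax}$: $\vdash a,\bar a$; $\vee$: from $\vdash\Gamma,A,B$ infer $\vdash\Gamma,A\vee B$; $\wedge$: from $\vdash\Gamma,A$ and $\vdash B,\Delta$ infer $\vdash\Gamma,A\wedge B,\Delta$; $\mathsf t$: $\vdash\mathsf t$; $\mathsf f$: from $\vdash\Gamma$ infer $\vdash\Gamma,\mathsf f$; $\mathsf{mix}$: from $\vdash\Gamma$, $\vdash\Delta$ infer $\vdash\Gamma,\Delta$; $\exists$: from $\vdash\Gamma,A[x/t]$ infer $\vdash\Gamma,\exists x.A$; $\forall$: from $\vdash\Gamma,A$ infer $\vdash\Gamma,\forall x.A$ if $x$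 not free in $\Gamma$. $\mathcal G(\Gamma)=\mathcal G(\bigvee\Gamma)$, where $\mathcal G(a)$ is one vertex labelled $a$, $\mathcal G(A\vee B)=\mathcal G(A)+\mathcal G(B)$ (disjoint union), $\mathcal G(A\wedge B)=\mathcal G(A)\times\mathcal G(B)$ (disjoint union plus all edges between the two parts), $\mathcal G(\exists x.A)=\bullet_x\times\mathcal G(A)$, $\mathcal G(\forall x.A)=\bullet_x+\mathcal G(A)$, with $\bullet_x$ a single vertex labelled $x$; so vertices correspond to atom and quantifier occurrences. Tracing atom occurrences upward in $\Pi$ (an occurrence in $A[x/t]$ in the premise of an $\exists$ instance corresponding to the occurrence in $\exists x.A$), each atom occurrence of $\Gamma$ originates in an instance of $\mathsf{ax}$ or of $\mathsf t$; $\sim_\Pi$ relates two atom occurrences iff they originate in the same $\mathsf{ax}$ instance. $\delta_\Pi$ is the substitution mapping $x$ to $t$ for every $\exists$ instance in $\Pi$ deriving $\exists x.A$ from $A[x/t]$. Fograph notions: a module of a graph is a vertex set $M$ with $N(v)\setminus M=N(w)\setminus M$ for $v,w\in M$; strong if every module contains it, is contained in it or is disjoint from it; proper if $|M|\ge2$. Vertices labelled by atoms are literals, by variables $x$ are $x$-binders. The scope of a binder is the smallest proper strong module containing it; an $x$-binder binds every literal in its scope whose atom contains $x$; a binder is existential (universal) if adjacent (non-adjacent) to all other vertices of its scope. Two atoms are pre-dual if neither is $\mathsf t,\mathsf f$ and their predicate symbols are $p$ and $\bar p$. A linked fograph is a fograph (here $\mathcal G(\Gamma)$) with a partial equivalence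 relation on vertices whose classes (links) are pairs of pre-dual literals, every literal labelled $\mathsf t$ or in a link. A dualizer is a substitution $\delta$ with $\ell(w)\delta=\overline{\ell(v)\delta}$ for each link $\{v,w\}$. A dependency is a pair of an existential $x$-binder and a universal $y$-binder such that the most general dualizer maps $x$ to a term containing $y$. The leap graph has the same vertices with edges the links and dependencies. A nonempty vertex set $W$ induces a matching in a graph if each $w\in W$ has exactly one neighbour in $W$; it induces a bimatching if it induces a matching in both the fograph and the leap graph. A fonet is a linked fograph that has a dualizer and no induced bimatching. *)

(* Defs.v *)
(* Fonets (first-order proof nets without syntax) and the sequent calculus
   MLL1^X, over plain Mathematical Components. *)
From mathcomp Require Import all_boot.

Set Implicit Arguments.
Unset Strict Implicit.
Unset Printing Implicit Defensive.

(** * Formulas *)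

Notation var := nat (only parsing).

(* [psym] contains one member p of every dual pair of predicate symbols p,
   \bar p; the boolean of an atom [Pred b p ts] says which one is meant. *)
Record signature := Signature {
  fsym : Type;
  farity : fsym -> nat;
  psym : Type;
  parity : psym -> nat }.

Inductive term (S : signature) : Type :=
| Var (x : var)
| Fun (f : fsym S) (ts : {ffun 'I_(farity f) -> term S}).

Inductive atom (S : signature) : Type :=
| Tru
| Fls
| Pred (b : bool) (p : psym S) (ts : {ffun 'I_(parity p) -> term S}).

Inductive formula (S : signature) : Type :=
| Atom (a : atom S)
| And (A B : formula S)
| Or (A B : formula S)
| Ex (x : var) (A : formula S)
| All (x : var) (A : formula S).

Arguments Var {S} x.
Arguments Tru {S}.
Arguments Fls {S}.

Definition dual S (a : atom S) : atom S :=
  match a with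
  | Tru => Fls
  | Fls => Tru
  | Pred b p ts => Pred (~~ b) ts
  end.

Definition pre_dual S (a b : atom S) : Prop :=
  match a, b with
  | Pred c p _, Pred d q _ => p = q /\ d = ~~ c
  | _, _ => False
  end.

(** * Variables and substitution *)

Fixpoint occurs_term S (x : var) (t : term S) : bool :=
  match t with
  | Var y => x == y
  | Fun f ts => [exists i, occurs_term x (ts i)]
  end.

Definition occurs_atom S (x : var) (a : atom S) : bool :=
  if a is Pred _ _ ts then [exists i, occurs_term x (ts i)] else false.

Fixpoint free S (x : var) (A : formula S) : bool :=
  match A with
  | Atom a => occurs_atom x a
  | And A B | Or A B => free x A || free x B
  | Ex y A | All y A => (x != y) && free x A
  end.

Fixpoint bound_vars S (A : formula S) : seq var :=
  match A with
  | Atom _ => [::]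
  | And A B | Or A B => bound_vars A ++ bound_vars B
  | Ex x A | All x A => x :: bound_vars A
  end.

Definition subst (S : signature) := var -> term S.

Fixpoint subst_term S (s : subst S) (t : term S) : term S :=
  match t with
  | Var y => s y
  | Fun f ts => Fun [ffun i => subst_term s (ts i)]
  end.

Definition subst_atom S (s : subst S) (a : atom S) : atom S :=
  match a with
  | Tru => Tru
  | Fls => Fls
  | Pred b p ts => Pred b [ffun i => subst_term s (ts i)]
  end.

Definition subst1 S (x : var) (t : term S) : subst S :=
  fun y => if y == x then t else Var y.

(* A[x/t].  No bound variable is ever renamed, so this is the intended
   substitution only under [free_for x t A]. *)
Fixpoint instantiate S (x : var) (t : term S) (A : formula S) : formula S :=
  match A with
  | Atom a => Atom (subst_atom (subst1 x t) a)
  | And A B => And (instantiate x t A) (instantiate x t B)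
  | Or A B => Or (instantiate x t A) (instantiate x t B)
  | Ex y A => Ex y (if y == x then A else instantiate x t A)
  | All y A => All y (if y == x then A else instantiate x t A)
  end.

(* No free occurrence of [x] in [A] is below a quantifier binding a variable
   of [t], i.e., A[x/t] captures nothing. *)
Fixpoint free_for S (x : var) (t : term S) (A : formula S) : bool :=
  match A with
  | Atom _ => true
  | And A B | Or A B => free_for x t A && free_for x t B
  | Ex y A | All y A =>
      (x == y) || ~~ free x A || (~~ occurs_term y t && free_for x t A)
  end.

Fixpoint fls_free S (A : formula S) : bool :=
  match A with
  | Atom a => if a is Fls then false else true
  | And A B | Or A B => fls_free A && fls_free B
  | Ex _ A | All _ A => fls_free A
  end.

(** * Sequents *)

(* Sequents are finite multisets, represented by lists together with the
   exchange rule of [deriv]. *)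
Notation sequent S := (seq (formula S)).

(* The value on the empty list is a dummy: the empty sequent is not derivable. *)
Fixpoint disj S (G : sequent S) : formula S :=
  if G is A :: G' then
    if G' is [::] then A else Or A (disj G')
  else Atom Fls.

Definition rectified_formula S (A : formula S) : bool :=
  uniq (bound_vars A) && all (fun x => ~~ free x A) (bound_vars A).

Definition rectified S (G : sequent S) : bool := rectified_formula (disj G).

(** * The calculus MLL1^X *)

(* Proofs live in [Type]: linkings and substitutions are read off them. *)
Inductive deriv (S : signature) : sequent S -> Type :=
| d_ax a : deriv [:: Atom a; Atom (dual a)]
| d_or A B G : deriv (A :: B :: G) -> deriv (Or A B :: G)
| d_and A B G D : deriv (A :: G) -> deriv (B :: D) -> deriv (And A B :: G ++ D)
| d_tru : deriv [:: Atom Tru]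
| d_fls G : deriv G -> deriv (Atom Fls :: G)
| d_mix G D : deriv G -> deriv D -> deriv (G ++ D)
| d_ex x t A G : free_for x t A ->
    deriv (instantiate x t A :: G) -> deriv (Ex x A :: G)
| d_all x A G : all (fun B => ~~ free x B) G ->
    deriv (A :: G) -> deriv (All x A :: G)
| d_exch (s : seq nat) G : perm_eq s (iota 0 (size G)) ->
    deriv G -> deriv [seq nth (Atom Fls) G i | i <- s].

(* The origin of an atom occurrence: [Some q] for the instance of ax at
   position [q] of the proof tree (the left/right choices at the binary rules
   between the root and the leaf, last choice first), [None] for instances of t and f.
   [origins P q] lists, formula by formula and from left to right, the origins
   of the atom occurrences of the conclusion of a proof [P] located at [q]. *)
Notation origin := (option (seq bool)).

Fixpoint origins S (G : sequent S) (P : deriv G) (q : seq bool) :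
    seq (seq origin) :=
  match P with
  | d_ax _ => [:: [:: Some q]; [:: Some q]]
  | d_or _ _ _ P1 =>
      if origins P1 q is oA :: oB :: oG then (oA ++ oB) :: oG else [::]
  | d_and _ _ _ _ P1 P2 =>
      match origins P1 (true :: q), origins P2 (false :: q) with
      | oA :: oG, oB :: oD => (oA ++ oB) :: oG ++ oD
      | _, _ => [::]
      end
  | d_tru => [:: [:: None]]
  | d_fls _ P1 => [:: None] :: origins P1 q
  | d_mix _ _ P1 P2 => origins P1 (true :: q) ++ origins P2 (false :: q)
  | d_ex _ _ _ _ _ P1 => origins P1 q
  | d_all _ _ _ _ P1 => origins P1 q
  | d_exch s _ _ P1 => let o := origins P1 q in [seq nth [::] o i | i <- s]
  end.

Fixpoint ex_instances S (G : sequent S) (P : deriv G) : seq (var * term S) :=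
  match P with
  | d_ax _ | d_tru => [::]
  | d_or _ _ _ P1 => ex_instances P1
  | d_and _ _ _ _ P1 P2 => ex_instances P1 ++ ex_instances P2
  | d_fls _ P1 => ex_instances P1
  | d_mix _ _ P1 P2 => ex_instances P1 ++ ex_instances P2
  | d_ex x t _ _ _ P1 => (x, t) :: ex_instances P1
  | d_all _ _ _ _ P1 => ex_instances P1
  | d_exch _ _ _ P1 => ex_instances P1
  end.

(* If the conclusion is rectified, each variable has at most one entry in
   [ex_instances P]. *)
Definition delta S (G : sequent S) (P : deriv G) : subst S :=
  foldr (fun e s y => if y == e.1 then e.2 else s y) Var (ex_instances P).

(** * Labelled graphs *)

Inductive label (S : signature) : Type :=
| Lit (a : atom S)
| Bnd (x : var).

Arguments Bnd {S} x.

Record lgraph (S : signature) := LGraph {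
  vertex :> finType;
  edge : rel vertex;
  lab : vertex -> label S;
  edge_sym : symmetric edge;
  edge_irr : irreflexive edge }.

Section Operations.
Variable S : signature.
Implicit Types G H : lgraph S.

Definition single (l : label S) : lgraph S :=
  @LGraph S unit (fun _ _ => false) (fun=> l) (fun _ _ => erefl) (fun=> erefl).

(* [cross] tells whether the two parts are completely joined. *)
Definition sum_edge (cross : bool) G H : rel (vertex G + vertex H) :=
  fun u v => match u, v with
  | inl a, inl b => edge a b
  | inr a, inr b => edge a b
  | _, _ => cross
  end.

Lemma sum_edge_sym c G H : symmetric (@sum_edge c G H).
Proof. by case=> a [] b //=; apply: edge_sym. Qed.

Lemma sum_edge_irr c G H : irreflexive (@sum_edge c G H).
Proof. by case=> a /=; apply: edge_irr. Qed.

Definition sum_lab G H (v : vertex G + vertex H) : label S :=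
  match v with inl a => lab a | inr b => lab b end.

Definition sum_graph c G H : lgraph S :=
  @LGraph S (vertex G + vertex H)%type (@sum_edge c G H) (@sum_lab G H)
    (@sum_edge_sym c G H) (@sum_edge_irr c G H).

Definition graph_union := sum_graph false.
Definition graph_join := sum_graph true.

End Operations.

Fixpoint graph S (A : formula S) : lgraph S :=
  match A with
  | Atom a => single (Lit a)
  | And A B => graph_join (graph A) (graph B)
  | Or A B => graph_union (graph A) (graph B)
  | Ex x A => graph_join (single (Bnd x)) (graph A)
  | All x A => graph_union (single (Bnd x)) (graph A)
  end.

Definition sequent_graph S (G : sequent S) : lgraph S := graph (disj G).

(** * Fographs and fonets *)

Section Fonets.
Variables (S : signature) (G : lgraph S).

Definition literal (v : G) : Prop := exists a, lab v = Lit a.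

Definition neighbours (v : G) : {set G} := [set w | edge v w].

Definition module (M : {set G}) : Prop :=
  {in M &, forall v w, neighbours v :\: M = neighbours w :\: M}.

Definition strong (M : {set G}) : Prop :=
  module M /\
  forall N : {set G}, module N ->
    [\/ M \subset N, N \subset M | [disjoint M & N]].

Definition proper_strong_module (M : {set G}) : Prop := strong M /\ 2 <= #|M|.

(* M is the smallest proper strong module containing b *)
Definition scope (b : G) (M : {set G}) : Prop :=
  [/\ proper_strong_module M, b \in M &
      forall N : {set G}, proper_strong_module N -> b \in N -> M \subset N].

Definition existential (b : G) : Prop :=
  (exists x, lab b = Bnd x) /\
  exists2 M, scope b M & forall v, v \in M -> v != b -> edge b v.

Definition universal (b : G) : Prop :=
  (exists x, lab b = Bnd x) /\
  exists2 M, scope b M & forall v, v \in M -> v != b -> ~~ edge b v.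

(* no induced P4 *)
Definition cograph : Prop :=
  forall a b c d : G,
    edge a b -> edge b c -> edge c d -> [|| edge a c, edge b d | edge a d].

(* the scope of an x-binder contains a literal and no other x-binder *)
Definition legal (b : G) : Prop :=
  exists2 M, scope b M &
    (exists2 v, v \in M & literal v) /\
    (forall v, v \in M -> v != b -> lab v <> lab b).

Definition fograph : Prop :=
  [/\ cograph, exists v : G, literal v &
      forall (b : G) x, lab b = Bnd x -> legal b].

Variable link : rel G.

Definition linked_fograph : Prop :=
  [/\ fograph,
      symmetric link /\ transitive link,
      forall v, link v v -> exists w a b,
        [/\ v != w, forall u, link v u = (u \in [set v; w]),
            lab v = Lit a, lab w = Lit b & pre_dual a b] &
      forall v a, lab v = Lit a -> a = Tru \/ link v v].

(* Dualizers act on the variables of existential binders only: all other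
   variables are rigid. *)
Definition dualizer (d : subst S) : Prop :=
  (forall x, (forall v : G, lab v = Bnd x -> ~ existential v) -> d x = Var x) /\
  forall (v w : G) a b, v != w -> link v w -> lab v = Lit a -> lab w = Lit b ->
    subst_atom d b = dual (subst_atom d a).

Definition most_general_dualizer (d : subst S) : Prop :=
  dualizer d /\
  forall d', dualizer d' -> exists s, forall x, d' x = subst_term s (d x).

(* Most general dualizers are unique up to a renaming of variables of
   existential binders, so the choice of [d] is irrelevant. *)
Definition dependency (v w : G) : Prop :=
  existential v /\ universal w /\
  exists x y d, [/\ lab v = Bnd x, lab w = Bnd y, most_general_dualizer d &
                    occurs_term y (d x)].

Definition leap (v w : G) : Prop :=
  (v != w /\ link v w) \/ dependency v w \/ dependency w v.

Definition induces_matching (e : G -> G -> Prop) (W : {set G}) : Prop :=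
  W != set0 /\ forall w, w \in W -> exists! v, v \in W /\ e w v.

Definition induces_bimatching (W : {set G}) : Prop :=
  induces_matching (fun v w => edge v w) W /\ induces_matching leap W.

Definition fonet : Prop :=
  [/\ linked_fograph, exists d, dualizer d &
      ~ exists W, induces_bimatching W].

End Fonets.

(** * The linked fograph of a proof *)

Fixpoint natoms S (A : formula S) : nat :=
  match A with
  | Atom _ => 1
  | And A B | Or A B => natoms A + natoms B
  | Ex _ A | All _ A => natoms A
  end.

(* The position of the literal [v] of [graph A] among the atom occurrences of
   [A], from left to right; [None] if [v] is a binder. *)
Fixpoint atom_index S (A : formula S) : graph A -> option nat :=
  match A return graph A -> option nat with
  | Atom _ => fun=> Some 0
  | And A B => fun v : vertex (graph A) + vertex (graph B) =>
      match v with
      | inl u => atom_index u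
      | inr u => omap (addn (natoms A)) (atom_index u)
      end
  | Or A B => fun v : vertex (graph A) + vertex (graph B) =>
      match v with
      | inl u => atom_index u
      | inr u => omap (addn (natoms A)) (atom_index u)
      end
  | Ex _ A => fun v : unit + vertex (graph A) =>
      if v is inr u then atom_index u else None
  | All _ A => fun v : unit + vertex (graph A) =>
      if v is inr u then atom_index u else None
  end.

Definition vertex_origin S (G : sequent S) (P : deriv G)
    (v : sequent_graph G) : origin :=
  obind (nth None (flatten (origins P [::]))) (atom_index v).

(* The vertices v and w are atom occurrences with the same instance of ax. *)
Definition proof_link S (G : sequent S) (P : deriv G) : rel (sequent_graph G) :=
  fun v w => (vertex_origin P v != None) &&
             (vertex_origin P v == vertex_origin P w).

(* Main.v *)
(* Every vertex of the conclusion is named, from the leaves of the proof down,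
   by its binder or by the axiom it originates from, which turns the fograph
   into a cotree built along the proof.

   No bimatching: by induction on the proof, for any set of leaps contained
   in the axiom links and the pairs (x, y) such that the term instantiating
   x contains the eigenvariable y. A universal binder introduced last is
   isolated in the fograph, an existential binder introduced last has no
   leaps (the eigenvariables above it do not occur in its witness), and
   neither kind of leap joins the two premises of a binary rule. If a
   bimatching crosses the two conjuncts of a conjunction introduced last, it
   does so in a single edge; the vertices of the bimatching in one premise
   are then paired by leaps, so even in number, and all but one of them are
   paired by edges, so odd in number.

   Dependencies: eigenvariables need not be fresh outside their condition,
   so a witness may mention the variable of an unrelated universal binder.
   Renaming such occurrences yields another dualizer in which this no longer
   happens; the most general dualizer maps x to a term containing y only if
   this one does.

   Scopes: the largest module in which a binder is adjacent to every (to no)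
   other vertex is strong, hence contains the scope of the binder. *)
Require Import Defs.
From mathcomp Require Import all_boot.

Set Implicit Arguments.
Unset Strict Implicit.
Unset Printing Implicit Defensive.

(** * Terms, atoms and substitutions *)

Section Substitution.
Variable S : signature.
Implicit Types (t : term S) (a : atom S) (A : formula S) (s r : subst S).

(** The arguments of a function symbol sit inside a finite function; this principle supplies an
    induction hypothesis for each of them. *)
Lemma term_nested_ind (P : term S -> Prop) :
    (forall x, P (Var x)) ->
    (forall f (ts : {ffun 'I_(farity f) -> term S}),
        (forall i, P (ts i)) -> P (Fun ts)) ->
  forall t, P t.
Proof.
move=> PV PF; fix IH 1 => -[x|f ts]; first exact: PV.
by apply: PF => i; apply: IH.
Qed.

Lemma eq_subst_term s r t :
  (forall x, occurs_term x t -> s x = r x) -> subst_term s t = subst_term r t.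
Proof.
elim/term_nested_ind: t => [x|f ts IH] /= sr; first by apply: sr.
congr Fun; apply/ffunP => i; rewrite !ffunE; apply: IH => x xi.
by apply: sr; apply/existsP; exists i.
Qed.

Lemma eq_subst_atom s r a :
  (forall x, occurs_atom x a -> s x = r x) -> subst_atom s a = subst_atom r a.
Proof.
case: a => //= b p ts sr; congr Pred; apply/ffunP => i; rewrite !ffunE.
by apply: eq_subst_term => x xi; apply: sr; apply/existsP; exists i.
Qed.

Lemma subst_term_Var t : subst_term Var t = t.
Proof.
elim/term_nested_ind: t => [x|f ts IH] //=.
by congr Fun; apply/ffunP => i; rewrite ffunE.
Qed.

Lemma subst_term_comp s r t :
  subst_term s (subst_term r t) = subst_term (fun x => subst_term s (r x)) t.
Proof.
elim/term_nested_ind: t => [x|f ts IH] //=.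
by congr Fun; apply/ffunP => i; rewrite !ffunE.
Qed.

Lemma subst_atom_comp s r a :
  subst_atom s (subst_atom r a) = subst_atom (fun x => subst_term s (r x)) a.
Proof.
case: a => //= b p ts; congr Pred.
by apply/ffunP => i; rewrite !ffunE subst_term_comp.
Qed.

Lemma occurs_subst_term y s t :
  occurs_term y (subst_term s t) <->
  exists2 x, occurs_term x t & occurs_term y (s x).
Proof.
elim/term_nested_ind: t => [x|f ts IH] /=.
  by split=> [yx|[z /eqP->]]; [exists x; rewrite ?eqxx|].
split=> [/existsP[i]|[x /existsP[i xi] yx]].
  rewrite ffunE => /IH[x xi yx]; exists x => //; by apply/existsP; exists i.
by apply/existsP; exists i; rewrite ffunE; apply/IH; exists x.
Qed.

Lemma subst_atom_dual s a : subst_atom s (dual a) = dual (subst_atom s a).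
Proof. by case: a. Qed.

Lemma dualK a : dual (dual a) = a.
Proof. by case: a => //= b p ts; rewrite negbK. Qed.

(** Substitution changes neither units nor predicate symbols, and a dual pair of units would contain
    [Fls]. *)
Lemma pre_dual_subst s a b :
    a <> Fls -> b <> Fls -> subst_atom s b = dual (subst_atom s a) ->
  pre_dual a b.
Proof.
case: a b => [||c p u] [||d q w] //= _ _ E.
by injection E => _ pq dc; rewrite pq dc.
Qed.

Definition upd s x t : subst S := fun y => if y == x then t else s y.

(** The fold of [delta], for any list of pairs; the first entry of a variable wins. *)
Definition lookup (l : seq (var * term S)) : subst S :=
  foldr (fun e s => upd s e.1 e.2) Var l.

Lemma lookup_notin l x : x \notin [seq e.1 | e <- l] -> lookup l x = Var x.
Proof.
elim: l => //= e l IH; rewrite inE negb_or => /andP[xe xl].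
by rewrite /upd (negPf xe) IH.
Qed.

(** One fixed substitution is compared with the instances of every subproof: [agrees] splits along
    concatenations, whereas [lookup] of a part is a different substitution. *)
Fixpoint agrees s (l : seq (var * term S)) : Prop :=
  if l is e :: l' then s e.1 = e.2 /\ agrees s l' else True.

Lemma agrees_cat s l1 l2 : agrees s (l1 ++ l2) <-> agrees s l1 /\ agrees s l2.
Proof. by elim: l1 => [|e l1 IH] /=; tauto. Qed.

Lemma agrees_lookup l : uniq [seq e.1 | e <- l] -> agrees (lookup l) l.
Proof.
move=> ul; have : forall x, x \in [seq e.1 | e <- l] ->
  lookup l x = lookup l x by [].
(* Generalize to any [s] that coincides with [lookup l] on the domain of [l]; this hypothesis passes
   to the tail, where the head entry is no longer visible. *)
move: {1 3}(lookup l) ul => s; elim: l => [|e l IH] //=.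
case/andP=> el ul sl; split.
  by rewrite sl ?mem_head // /upd eqxx.
apply: IH => // x xl; rewrite sl ?inE ?xl ?orbT // /upd.
by case: eqP => // xe; rewrite -xe xl in el.
Qed.

End Substitution.

(** * Existentially and universally bound variables *)

Section Quantifiers.
Variable S : signature.
Implicit Types (t : term S) (A B : formula S) (G : seq (formula S)).

(* [k] is [true] for existential and [false] for universal quantifiers; the
   same convention is used for the vertices below. *)
Fixpoint qvars (k : bool) A : seq var :=
  match A with
  | Atom _ => [::]
  | And A B | Or A B => qvars k A ++ qvars k B
  | Ex x A => nseq k x ++ qvars k A
  | All x A => nseq (~~ k) x ++ qvars k A
  end.

Lemma perm_qvars A : perm_eq (qvars true A ++ qvars false A) (bound_vars A).
Proof.
elim: A => //= [A IHA B IHB|A IHA B IHB|x A IHA|x A IHA].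
- by rewrite perm_catACA perm_cat.
- by rewrite perm_catACA perm_cat.
- by rewrite perm_cons.
- by rewrite (perm_catCA _ [:: x]) /= perm_cons.
Qed.

Definition bvs G := flatten [seq bound_vars A | A <- G].
Definition qvs k G := flatten [seq qvars k A | A <- G].

Lemma perm_qvs G : perm_eq (qvs true G ++ qvs false G) (bvs G).
Proof.
elim: G => //= A G IH.
by rewrite /qvs /bvs /= perm_catACA perm_cat // perm_qvars.
Qed.

Lemma qvs_bvs k G x : x \in qvs k G -> x \in bvs G.
Proof.
by rewrite -(perm_mem (perm_qvs G)) mem_cat; case: k => -> //; rewrite orbT.
Qed.

Lemma bound_vars_instantiate x t A :
  bound_vars (instantiate x t A) = bound_vars A.
Proof.
by elim: A => //= [A -> B ->|A -> B ->|y A IH|y A IH] //; case: eqP => //;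
  rewrite ?IH.
Qed.

Lemma qvars_instantiate k x t A : qvars k (instantiate x t A) = qvars k A.
Proof.
by elim: A => //= [A -> B ->|A -> B ->|y A IH|y A IH] //; case: eqP => //;
  rewrite ?IH.
Qed.

Lemma fls_free_instantiate x t A : fls_free (instantiate x t A) = fls_free A.
Proof.
elim: A => //= [[]|A -> B ->|A -> B ->|y A IH|y A IH] //; case: eqP => //;
  rewrite ?IH.
Qed.

End Quantifiers.

(** * The cotrees of a proof *)

(* [inl (k, x)] is the binder of the quantifier [k] on [x]; [inr (q, Some b)]
   is one of the two atoms of the axiom at position [q], and [inr (q, None)] is
   the atom of the instance of t at position [q]. *)
Definition node : eqType := ((bool * var) + (seq bool * option bool))%type.

(** As in [sum_graph], the flag is [true] where the two sides are completely joined. *)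
Inductive cotree := Leaf of node | Join of bool & cotree & cotree.

Fixpoint leaves (T : cotree) : seq node :=
  match T with
  | Leaf v => [:: v]
  | Join _ L R => leaves L ++ leaves R
  end.

Fixpoint cedge (T : cotree) : rel node :=
  match T with
  | Leaf _ => fun _ _ => false
  | Join c L R => fun u v =>
      [|| cedge L u v, cedge R u v |
       c && ((u \in leaves L) && (v \in leaves R) ||
             (u \in leaves R) && (v \in leaves L))]
  end.

Definition node_origin (v : node) : origin :=
  if v is inr (q, Some _) then Some q else None.

Fixpoint cotree_origins (T : cotree) : seq origin :=
  match T with
  | Leaf (inl _) => [::]
  | Leaf v => [:: node_origin v]
  | Join _ L R => cotree_origins L ++ cotree_origins R
  end.

(** A proof yields a forest, one cotree for each formula of its conclusion; no edge joins different
    trees. *)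
Definition cleaves (F : seq cotree) : seq node :=
  flatten [seq leaves T | T <- F].
Definition fedge (F : seq cotree) : rel node :=
  fun u v => has (fun T => cedge T u v) F.

Definition no_cotree := Leaf (inl (true, 0)).

Lemma cedge_sym T : symmetric (cedge T).
Proof.
elim: T => //= c L IHL R IHR u v; rewrite IHL IHR; congr [|| _, _ | _ && _].
by rewrite orbC; congr (_ || _); rewrite andbC.
Qed.

Lemma cedge_leaves T u v : cedge T u v -> (u \in leaves T) && (v \in leaves T).
Proof.
elim: T => //= c L IHL R IHR; rewrite !mem_cat.
case/or3P => [/IHL/andP[-> ->]|/IHR/andP[-> ->]|] //; first by rewrite !orbT.
by case/andP=> _ /orP[] /andP[-> ->]; rewrite !orbT.
Qed.

Lemma fedge_sym F : symmetric (fedge F).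
Proof. by move=> u v; apply: eq_has => T; rewrite cedge_sym. Qed.

Lemma fedge_leaves F u v : fedge F u v -> (u \in cleaves F) &&
  (v \in cleaves F).
Proof.
elim: F => //= T F IH; rewrite /cleaves /= !mem_cat.
by case/orP=> [/cedge_leaves|/IH] /andP[-> ->]; rewrite ?orbT.
Qed.

Lemma cedge_irr T u : uniq (leaves T) -> cedge T u u = false.
Proof.
elim: T => //= c L IHL R IHR;
  rewrite cat_uniq => /and3P[/IHL-> /hasPn dis /IHR->].
apply/negP => /andP[_] /orP[] /andP[]; first by move=> uL /dis /negP[].
by move=> /dis /negP.
Qed.

Lemma fedge_irr F u : uniq (cleaves F) -> fedge F u u = false.
Proof.
elim: F => //= T F IH; rewrite /cleaves /= cat_uniq => /and3P[uT _ /IH uF].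
by rewrite cedge_irr //= uF.
Qed.

Lemma fedge_cons T F u v : fedge (T :: F) u v = cedge T u v || fedge F u v.
Proof. by []. Qed.

Lemma fedge_cat F1 F2 u v : fedge (F1 ++ F2) u v = fedge F1 u v || fedge F2 u v.
Proof. exact: has_cat. Qed.

Lemma cleaves_cat F1 F2 : cleaves (F1 ++ F2) = cleaves F1 ++ cleaves F2.
Proof. by rewrite /cleaves map_cat flatten_cat. Qed.

Lemma cleaves_cons T F : cleaves (T :: F) = leaves T ++ cleaves F.
Proof. by []. Qed.

(** * Lists reordered by the exchange rule *)

Section Exchange.

Variables (X : Type) (x0 : X) (F : seq X) (s : seq nat).
Hypothesis s_perm : perm_eq s (iota 0 (size F)).

Lemma perm_map_exchange (Y : eqType) (f : X -> Y) :
  perm_eq [seq f (nth x0 F i) | i <- s] [seq f T | T <- F].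
Proof.
rewrite -[in X in perm_eq _ X](mkseq_nth x0 F) /mkseq -map_comp.
exact: perm_map.
Qed.

Lemma perm_flatten_exchange (Y : eqType) (f : X -> seq Y) :
  perm_eq (flatten [seq f T | T <- [seq nth x0 F i | i <- s]])
          (flatten [seq f T | T <- F]).
Proof. by apply: perm_flatten; rewrite -map_comp perm_map_exchange. Qed.

Lemma has_exchange (a : pred X) : has a [seq nth x0 F i | i <- s] = has a F.
Proof.
rewrite -(has_map a id) -[RHS](has_map a id); apply: perm_has.
by rewrite -map_comp perm_map_exchange.
Qed.

Lemma all_exchange (a : pred X) : all a [seq nth x0 F i | i <- s] = all a F.
Proof.
rewrite -(all_map a id) -[RHS](all_map a id); apply: perm_all.
by rewrite -map_comp perm_map_exchange.
Qed.

Lemma nth_exchange i : i < size s -> nth 0 s i < size F.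
Proof.
by move=> lti; have := mem_nth 0 lti; rewrite (perm_mem s_perm) mem_iota add0n.
Qed.

End Exchange.

(** * Relating a sequent to a forest formula by formula *)

Section Pointwise.

Variables (S : signature) (Q : formula S -> cotree -> Prop).
Implicit Types (G D : seq (formula S)) (E F : seq cotree).

Definition pointwise G F : Prop :=
  size F = size G /\
  forall i, i < size G -> Q (nth (Atom Fls) G i) (nth no_cotree F i).

Lemma pointwise_cons A T G F : Q A T -> pointwise G F ->
  pointwise (A :: G) (T :: F).
Proof. by move=> QAT [sF QF]; split=> [|[|i]] //=; [rewrite sF|apply: QF]. Qed.

Lemma pointwise_inv A G F : pointwise (A :: G) F ->
  exists T F', [/\ F = T :: F', Q A T & pointwise G F'].
Proof.
case: F => [|T F] [] //= [sF] QF; exists T, F; split=> //; first exact: (QF 0).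
by split=> // i; apply: (QF i.+1).
Qed.

Lemma pointwise_cat G D E F : pointwise G E -> pointwise D F ->
  pointwise (G ++ D) (E ++ F).
Proof.
move=> [sE QE] [sF QF]; split=> [|i]; first by rewrite !size_cat sE sF.
rewrite size_cat !nth_cat sE; case: (ltnP i (size G)) => [lt _|le lt].
  exact: QE.
by apply: QF; rewrite ltn_subLR.
Qed.

Lemma pointwise_exchange s G F : perm_eq s (iota 0 (size G)) ->
  pointwise G F ->
  pointwise [seq nth (Atom Fls) G i | i <- s] [seq nth no_cotree F i | i <- s].
Proof.
move=> ps [sF QF]; split=> [|i]; rewrite !size_map // => lti.
by rewrite !(nth_map 0) //; apply: QF; apply: nth_exchange.
Qed.

End Pointwise.

Lemma pointwise_impl S (Q Q' : formula S -> cotree -> Prop) G F :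
    (forall i, i < size G -> Q (nth (Atom Fls) G i) (nth no_cotree F i) ->
               Q' (nth (Atom Fls) G i) (nth no_cotree F i)) ->
  pointwise Q G F -> pointwise Q' G F.
Proof. by move=> QQ' [sF QF]; split=> // i lti; apply: QQ'; auto. Qed.

(** * The forest read off a proof *)

Section Trees.

Variable S : signature.
Implicit Types (A B : formula S) (G : seq (formula S)) (T : cotree).
Implicit Types (s r : subst S).

(** Same recursion as [origins], but each quantifier and connective is recorded when it is
    introduced. The branches with value [[::]] are excluded by [trees_fits]. *)
Fixpoint trees G (P : deriv G) (q : seq bool) : seq cotree :=
  match P with
  | d_ax _ => [:: Leaf (inr (q, Some false)); Leaf (inr (q, Some true))]
  | d_or _ _ _ P1 =>
      if trees P1 q is L :: R :: F then Join false L R :: F else [::]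
  | d_and _ _ _ _ P1 P2 =>
      match trees P1 (true :: q), trees P2 (false :: q) with
      | L :: E, R :: F => Join true L R :: E ++ F
      | _, _ => [::]
      end
  | d_tru => [:: Leaf (inr (q, None))]
  | d_fls _ P1 => Leaf (inr (q, None)) :: trees P1 q
  | d_mix _ _ P1 P2 => trees P1 (true :: q) ++ trees P2 (false :: q)
  | d_ex x _ _ _ _ P1 =>
      if trees P1 q is T :: F then Join true (Leaf (inl (true, x))) T :: F
      else [::]
  | d_all x _ _ _ P1 =>
      if trees P1 q is T :: F then Join false (Leaf (inl (false, x))) T :: F
      else [::]
  | d_exch s _ _ P1 => let F := trees P1 q in [seq nth no_cotree F i | i <- s]
  end.

Fixpoint fits A T : bool :=
  match A, T with
  | Atom _, Leaf (inr _) => true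
  | And A B, Join true L R => fits A L && fits B R
  | Or A B, Join false L R => fits A L && fits B R
  | Ex x A, Join true (Leaf v) R => (v == inl (true, x)) && fits A R
  | All x A, Join false (Leaf v) R => (v == inl (false, x)) && fits A R
  | _, _ => false
  end.

Lemma fits_instantiate x t A T : fits (instantiate x t A) T = fits A T.
Proof.
elim: A T => //= [A IHA B IHB|A IHA B IHB|y A IHA|y A IHA] [v|[] L R] //=.
- by rewrite IHA IHB.
- by rewrite IHA IHB.
- by case: L => // v; case: ifP; rewrite ?IHA.
- by case: L => // v; case: ifP; rewrite ?IHA.
Qed.

Lemma trees_fits G (P : deriv G) q : pointwise fits G (trees P q).
Proof.
elim: P q => {G} /=.
- by move=> a q; do 2![apply: pointwise_cons => //].
- move=> A B G P IH q; case/pointwise_inv: (IH q) => L [? [-> fL]].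
  by case/pointwise_inv=> R [F [-> fR fF]]; apply: pointwise_cons;
    rewrite //= fL.
- move=> A B G D P1 IH1 P2 IH2 q.
  case/pointwise_inv: (IH1 (true :: q)) => L [E [-> fL fE]].
  case/pointwise_inv: (IH2 (false :: q)) => R [F [-> fR fF]].
  by apply: pointwise_cons; rewrite /= ?fL //; apply: pointwise_cat.
- by move=> q; apply: pointwise_cons.
- by move=> G P IH q; apply: pointwise_cons.
- by move=> G D P1 IH1 P2 IH2 q; apply: pointwise_cat.
- move=> x t A G fr P IH q; case/pointwise_inv: (IH q) => T [F [-> fT fF]].
  by apply: pointwise_cons; rewrite //= eqxx -(fits_instantiate x t).
- move=> x A G fr P IH q; case/pointwise_inv: (IH q) => T [F [-> fT fF]].
  by apply: pointwise_cons; rewrite //= eqxx.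
- by move=> s G ps P IH q; apply: pointwise_exchange.
Qed.

Lemma origins_trees G (P : deriv G) q :
  origins P q = [seq cotree_origins T | T <- trees P q].
Proof.
elim: P q => {G} //=.
- by move=> A B G P IH q; rewrite IH; case: (trees P q) => [|L [|R F]].
- move=> A B G D P1 IH1 P2 IH2 q; rewrite IH1 IH2.
  case: (trees P1 _) (trees P2 _) => [|L E] [|R F] //=.
  by rewrite map_cat.
- by move=> G P IH q; rewrite IH.
- by move=> G D P1 IH1 P2 IH2 q; rewrite IH1 IH2 map_cat.
- by move=> x t A G fr P IH q; rewrite IH; case: (trees P q).
- by move=> x A G fr P IH q; rewrite IH; case: (trees P q).
- move=> s G ps P IH q; rewrite IH -map_comp; apply: eq_map => i /=.
  case: (ltnP i (size (trees P q))) => lti;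
    first by rewrite (nth_map no_cotree).
  by rewrite !nth_default // size_map.
Qed.

Lemma fits_binder A T k x : fits A T ->
  (inl (k, x) \in leaves T) = (x \in qvars k A).
Proof.
have nseqE (b : bool) y z : (y \in nseq b z) = b && (y == z :> nat).
  by case: b; rewrite //= inE.
elim: A T => /= [a [[]|]|A IHA B IHB [|[] L R]|A IHA B IHB [|[] L R]
  |y A IHA [|[] [v|] R]|y A IHA [|[] [v|] R]] //=.
- by case/andP=> fL fR; rewrite !mem_cat IHA ?IHB.
- by case/andP=> fL fR; rewrite !mem_cat IHA ?IHB.
- by case/andP=> /eqP-> fR; rewrite inE mem_cat IHA // nseqE; case: k {IHA}.
- by case/andP=> /eqP-> fR; rewrite inE mem_cat IHA // nseqE; case: k {IHA}.
Qed.

Lemma trees_binder G (P : deriv G) q k x :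
  (inl (k, x) \in cleaves (trees P q)) = (x \in qvs k G).
Proof.
move: (trees P q) (trees_fits P q) => F {P}.
elim: G F => [|A G IH] F; first by case: F => [|? ?] [].
case/pointwise_inv=> T [F' [-> fT fF]].
by rewrite cleaves_cons /qvs /= !mem_cat IH // (fits_binder _ _ fT).
Qed.

(** Positions grow at the front, so [q] remains a suffix of all positions above it; this tells apart
    the leaves of the two premises of a binary rule. *)
Lemma trees_positions G (P : deriv G) q p k :
  inr (p, k) \in cleaves (trees P q) -> exists l, p = l ++ q.
Proof.
elim: P q => {G} /=.
- by move=> a q; rewrite !inE => /orP[] /eqP[-> _]; exists [::].
- move=> A B G P IH q; have := IH q; case: (trees P q) => [|L [|R F]] //=.
  by rewrite !cleaves_cons /= catA.
- move=> A B G D P1 IH1 P2 IH2 q; have := (IH1 (true :: q), IH2 (false :: q)).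
  case: (trees P1 _) (trees P2 _) => [|L E] [|R F] // [{}IH1 {}IH2].
  rewrite cleaves_cons cleaves_cat /= !mem_cat => H.
  have: (inr (p, k) \in cleaves (L :: E)) || (inr (p, k) \in cleaves (R :: F)).
    by rewrite !cleaves_cons !mem_cat; case/orP: H => /orP[] ->; rewrite ?orbT.
  case/orP=> [/IH1|/IH2] [l ->].
  + by exists (rcons l true); rewrite cat_rcons.
  + by exists (rcons l false); rewrite cat_rcons.
- by move=> q; rewrite inE => /eqP[-> _]; exists [::].
- move=> G P IH q; rewrite cleaves_cons inE => /orP[/eqP[-> _]|];
  last exact: IH.
  by exists [::].
- move=> G D P1 IH1 P2 IH2 q; rewrite cleaves_cat mem_cat.
  case/orP=> [/IH1|/IH2] [l ->].
  + by exists (rcons l true); rewrite cat_rcons.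
  + by exists (rcons l false); rewrite cat_rcons.
- by move=> x t A G fr P IH q; have := IH q; case: (trees P q).
- by move=> x A G fr P IH q; have := IH q; case: (trees P q).
- move=> s G ps P IH q; have ps' := ps.
  rewrite -(trees_fits P q).1 in ps'.
  by rewrite (perm_mem (perm_flatten_exchange no_cotree ps' leaves)); apply: IH.
Qed.

End Trees.

(** * Matchings *)

Section Matchings.

Variable V : eqType.
Implicit Types (e E R : V -> V -> Prop) (W U : seq V).

Definition matched e W : Prop :=
  forall u, u \in W ->
    exists v, [/\ v \in W, e u v & forall w, w \in W -> e u w -> w = v].

(** Remove a vertex [u] together with its partner [v]: what remains is still matched. *)
Lemma matched_even e W : uniq W -> (forall u v, e u v -> e v u) ->
  (forall u, u \in W -> ~ e u u) -> matched e W -> ~~ odd (size W).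
Proof.
move=> + sym; have [n] := ubnP (size W).
elim: n W => // n IH [|u W] //= ltWn /andP[uW Wu] irr mat.
have [v [vW uv vP]] := mat u (mem_head _ _).
have{} vW : v \in W.
  by move: vW; rewrite inE => /predU1P[vu|//]; case: (irr u);
    rewrite ?mem_head // -{2}vu.
have remW w : w \in rem v W -> w \in W by apply: mem_rem.
have -> : size W = (size (rem v W)).+1.
  by rewrite size_rem // prednK //; case: (W) vW.
rewrite /= negbK; apply: IH; rewrite ?rem_uniq //.
- by rewrite size_rem // (leq_ltn_trans (leq_pred _)).
- by move=> w /remW wW; apply: irr; rewrite inE wW orbT.
- move=> w wr; have wW := remW _ wr.
  have [x [xW wx xP]] := mat w (mem_behead (wW : w \in behead (u :: W))).
  have wv : w != v by move: wr; rewrite mem_rem_uniq // inE => /andP[].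
  exists x; split=> // [|y /remW yW]; last by apply: xP; rewrite inE yW orbT.
  (* The partner [x] of [w] survives the removal: if it were [v], then [w] would be [u]; if it were
     [u], then [w] would be [v]. *)
  have [v' [_ _ v'P]] := mat v (mem_behead (vW : v \in behead (u :: W))).
  rewrite mem_rem_uniq // inE; apply/andP; split.
    apply/eqP=> xv; move: wx; rewrite xv => /sym vw.
    have wE := v'P w (mem_behead (wW : w \in behead (u :: W))) vw.
    have uE := v'P u (mem_head _ _) (sym _ _ uv).
    by rewrite uE -wE wW in uW.
  move: xW; rewrite inE => /predU1P[xu|//].
  by move: wx; rewrite xu => /sym /vP; rewrite inE wW orbT => /(_ isT) /eqP;
    rewrite (negPf wv).
Qed.

(* Only existence of a perfect matching inside [R] is excluded, not existence
   of an induced one: unlike the latter, this is monotone in [R], so [R] may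
   overestimate the leap graph. *)
Definition no_bimatching E R U : Prop :=
  forall e W, uniq W -> {subset W <= U} -> (forall u v, e u v -> e v u) ->
    (forall u, ~ e u u) -> (forall u v, e u v -> R u v) ->
  matched E W -> matched e W -> W = [::].

Lemma eq_no_bimatching E E' R U U' :
    (forall u v, E u v <-> E' u v) -> U =i U' ->
  no_bimatching E R U -> no_bimatching E' R U'.
Proof.
move=> EE UU nb e W uW sW sym irr eR mE me; apply: (nb e) => // [u /sW|u /mE].
  by rewrite UU.
case=> v [vW uv vP]; exists v; split=> //; first exact/EE.
by move=> w wW /EE; apply: vP.
Qed.

(** A vertex without edges, or without leaps, has no partner in one of the two matchings and so lies
    in no bimatching. This serves both quantifier rules. *)
Lemma no_bimatching_add v0 E E' R U :
    (forall u, u \in U -> ~ E' v0 u) \/ (forall u, u \in U -> ~ R v0 u) ->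
    ~ E' v0 v0 ->
    (forall u v, u \in U -> v \in U -> E' u v <-> E u v) ->
  no_bimatching E R U -> no_bimatching E' R (v0 :: U).
Proof.
move=> iso irr0 EE nb e W uW sW sym irr eR mE me.
suff v0W : v0 \notin W.
  have {}sW : {subset W <= U}.
    by move=> u uW'; move: (sW u uW'); rewrite inE => /predU1P[uv|//];
      rewrite -uv uW' in v0W.
  apply: (nb e) => // u uW'; have [v [vW uv vP]] := mE u uW'.
  exists v; split=> //; first by apply/EE; auto.
  by move=> w wW uw; apply: vP => //; apply/EE; auto.
apply/negP=> v0W; case: iso => iso.
  have [v [/sW + uv _]] := mE _ v0W; rewrite inE => /predU1P[vv|/iso//].
  by apply: irr0; rewrite -{2}vv.
have [v [/sW + uv _]] := me _ v0W; rewrite inE => /predU1P[vv|/iso].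
  by apply: (irr v0); rewrite -{2}vv.
by apply; apply: eR.
Qed.

(* A bimatching that uses a joining edge uses exactly one; its vertices in one
   half are paired by leaps, and without the end point of that edge they are
   paired by edges, so their number is both even and odd. *)
Lemma no_bimatching_sum (c : bool) (L M : seq V) E1 E2 E R U1 U2 :
    (forall u v, E u v <-> [\/ E1 u v, E2 u v |
       c /\ (u \in L /\ v \in M \/ u \in M /\ v \in L)]) ->
    (forall u v, E u v -> E v u) -> (forall u, ~ E u u) ->
    (forall u v, E1 u v -> u \in U1 /\ v \in U1) ->
    (forall u v, E2 u v -> u \in U2 /\ v \in U2) ->
    {subset L <= U1} -> {subset M <= U2} ->
    (forall u, u \in U1 -> u \in U2 -> False) ->
    (forall u v, u \in U1 -> v \in U2 -> ~ R u v) ->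
    no_bimatching E1 R U1 -> no_bimatching E2 R U2 ->
  no_bimatching E R (U1 ++ U2).
Proof.
move=> EP Esym Eirr E1U E2U LU MU disj RU nb1 nb2 e W uW sW sym irr eR mE me.
(* Leaps do not cross, so [e] restricts to a matching of each half. *)
have me1 : matched e [seq u <- W | u \in U1].
  move=> u; rewrite mem_filter => /andP[uU uW'];
    have [v [vW uv vP]] := me u uW'.
  exists v; split=> // [|w]; rewrite mem_filter; last by case/andP=> _;
    apply: vP.
  rewrite vW andbT; have := sW v vW; rewrite mem_cat => /orP[//|vU].
  by case: (RU u v); auto.
have me2 : matched e [seq u <- W | u \in U2].
  move=> u; rewrite mem_filter => /andP[uU uW'];
    have [v [vW uv vP]] := me u uW'.
  exists v; split=> // [|w]; rewrite mem_filter; last by case/andP=> _;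
    apply: vP.
  rewrite vW andbT; have := sW v vW; rewrite mem_cat => /orP[vU|//].
  by case: (RU v u); auto.
have [cross|ncross] := boolP [&& c, has (mem L) W & has (mem M) W].
  case/and3P: cross => tc /hasP[/= a aW aL] /hasP[/= b bW bM].
  have aU := LU _ aL; have bU := MU _ bM.
  have ab : E a b by apply/EP; apply: Or33; auto.
  have [b' [_ _ bP]] := mE a aW; have [a' [_ _ aP]] := mE b bW.
  have bb := bP b bW ab; have aa := aP a aW (Esym _ _ ab); subst a' b'.
  (* Another vertex of [L] in [W] would be a second neighbour of [b]. *)
  have La u : u \in W -> u \in L -> u = a.
    by move=> uW' uL; apply: aP => //; apply: Esym; apply/EP; apply: Or33; auto.
  set W1 := [seq u <- W | u \in U1]; have uW1 : uniq W1 by rewrite filter_uniq.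
  have aW1 : a \in W1 by rewrite mem_filter aU aW.
  have ev : ~~ odd (size W1) by apply: (@matched_even e) => // u _; apply: irr.
  (* The only crossing edge starts at [a], so every other vertex of [W1] has its [E]-partner in
     [W1], and this partner is not [a]. *)
  have : ~~ odd (size (rem a W1)).
    apply: (@matched_even E) => //; first by rewrite rem_uniq.
    move=> u; rewrite mem_rem_uniq // inE mem_filter => /and3P[ua uU1 uW'].
    have [v [vW uv vP]] := mE u uW'; exists v; split=> //; last first.
      by move=> w /mem_rem; rewrite mem_filter => /andP[_]; apply: vP.
    rewrite mem_rem_uniq // inE mem_filter vW andbT; apply/andP; split.
      apply/eqP=> va; subst v; have ub := bP u uW' (Esym _ _ uv).
      by apply: (disj b) => //; rewrite -ub.
    case/EP: uv => [/E1U[]//|/E2U[uU2]|[_ [[uL _]|[uM _]]]].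
    - by case: (disj u).
    - by rewrite (La u) ?eqxx in ua.
    - by case: (disj u) => //; apply: MU.
  rewrite size_rem // -(prednK (_ : 0 < size W1)) /= in ev *;
    last by case: (W1) aW1.
  by rewrite (negPf ev).
(* No crossing edge within [W]: each half of [W] is matched by both relations, hence empty. *)
have nX u v : u \in W -> v \in W -> E u v -> E1 u v \/ E2 u v.
  move=> uW' vW /EP[|| [tc X]]; auto; case/negP: ncross; rewrite tc /=.
  by case: X => [[uL vM]|[uM vL]]; apply/andP; split; apply/hasP;
    by [exists u | exists v].
have W1 : [seq u <- W | u \in U1] = [::].
  apply: (nb1 e) => //; first by rewrite filter_uniq.
    by move=> u; rewrite mem_filter => /andP[].
  move=> u; rewrite mem_filter => /andP[uU uW'];
    have [v [vW uv vP]] := mE u uW'.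
  have uv1 : E1 u v by case: (nX u v) => // /E2U[uU2]; case: (disj u).
  exists v; split=> //; first by rewrite mem_filter vW (E1U _ _ uv1).2.
  by move=> w; rewrite mem_filter => /andP[_ wW] uw; apply: vP => //; apply/EP;
    apply: Or31.
have W2 : [seq u <- W | u \in U2] = [::].
  apply: (nb2 e) => //; first by rewrite filter_uniq.
    by move=> u; rewrite mem_filter => /andP[].
  move=> u; rewrite mem_filter => /andP[uU uW'];
    have [v [vW uv vP]] := mE u uW'.
  have uv2 : E2 u v by case: (nX u v) => // /E1U[uU1]; case: (disj u).
  exists v; split=> //; first by rewrite mem_filter vW (E2U _ _ uv2).2.
  by move=> w; rewrite mem_filter => /andP[_ wW] uw; apply: vP => //; apply/EP;
    apply: Or32.
case: (W) sW W1 W2 => // u W' sW W1 W2.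
have := sW u (mem_head _ _); rewrite mem_cat => /orP[] uU.
  by move: W1; rewrite /= uU.
by move: W2; rewrite /= uU.
Qed.

End Matchings.

(** * Absence of bimatchings in proofs *)

Section Proofs.

Variable S : signature.
Implicit Types (A B : formula S) (G D : seq (formula S)) (T : cotree).
Implicit Types (s r d : subst S).

Lemma bvs_cat G D : bvs (G ++ D) = bvs G ++ bvs D.
Proof. by rewrite /bvs map_cat flatten_cat. Qed.

Lemma qvs_cat k G D : qvs k (G ++ D) = qvs k G ++ qvs k D.
Proof. by rewrite /qvs map_cat flatten_cat. Qed.

Lemma uniq_bvs_And A B G D :
  uniq (bvs (And A B :: G ++ D)) = uniq (bvs (A :: G) ++ bvs (B :: D)).
Proof.
by rewrite /bvs /= map_cat flatten_cat; apply: perm_uniq; rewrite perm_catACA.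
Qed.

Lemma qvs_And k A B G D x :
  (x \in qvs k (And A B :: G ++ D)) =
  (x \in qvs k (A :: G)) || (x \in qvs k (B :: D)).
Proof. by rewrite /qvs /= map_cat flatten_cat !mem_cat orbACA. Qed.

Lemma bvs_instantiate x t A G : bvs (instantiate x t A :: G) = bvs (A :: G).
Proof. by rewrite /bvs /= bound_vars_instantiate. Qed.

Lemma qvs_instantiate k x t A G :
  qvs k (instantiate x t A :: G) = qvs k (A :: G).
Proof. by rewrite /qvs /= qvars_instantiate. Qed.

(** * Bound variables and leaves under exchange *)

Section Exchange.

Variables (G : seq (formula S)) (s : seq nat).
Hypothesis s_perm : perm_eq s (iota 0 (size G)).

Lemma bvs_exchange : uniq (bvs [seq nth (Atom Fls) G i | i <- s]) = uniq (bvs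
  G).
Proof. exact/perm_uniq/perm_flatten_exchange. Qed.

Lemma qvs_exchange k : qvs k [seq nth (Atom Fls) G i | i <- s] =i qvs k G.
Proof. exact/perm_mem/perm_flatten_exchange. Qed.

Lemma perm_trees (P : deriv G) q : perm_eq s (iota 0 (size (trees P q))).
Proof. by rewrite (trees_fits P q).1. Qed.

Lemma perm_cleaves_exchange (P : deriv G) q :
  perm_eq (cleaves [seq nth no_cotree (trees P q) i | i <- s])
          (cleaves (trees P q)).
Proof. exact/perm_flatten_exchange/perm_trees. Qed.

End Exchange.

(** Common to the two binary rules: a conjunction joins the leaves [L] and [M] of its conjuncts, mix
    joins nothing. *)
Lemma forest_no_bimatching_sum c (L M : seq node) E F H (R : rel node) :
    (forall u v, fedge H u v = [|| fedge E u v, fedge F u v |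
       c && ((u \in L) && (v \in M) || (u \in M) && (v \in L))]) ->
    uniq (cleaves H) ->
    {subset L <= cleaves E} -> {subset M <= cleaves F} ->
    (forall u, u \in cleaves E -> u \in cleaves F -> False) ->
    (forall u v, u \in cleaves E -> v \in cleaves F -> ~ R u v) ->
    no_bimatching (fedge E) R (cleaves E) ->
    no_bimatching (fedge F) R (cleaves F) ->
  no_bimatching (fedge H) R (cleaves E ++ cleaves F).
Proof.
move=> HE uH LE MF dis RU;
  apply: (no_bimatching_sum (c := c) (L := L) (M := M)) => //.
- move=> u v; rewrite HE; split.
    case/or3P=> [|| /andP[c1 /orP[] /andP[]]]; first exact: Or31.
    + exact: Or32.
    + by constructor 3; auto.
    + by constructor 3; auto.
  by case=> [->|->|[-> [[-> ->]|[-> ->]]]]; rewrite ?orbT.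
- by move=> u v; rewrite fedge_sym.
- by move=> u; rewrite fedge_irr.
- by move=> u v /fedge_leaves /andP.
- by move=> u v /fedge_leaves /andP.
Qed.

Lemma branches_neq (l1 l2 q : seq bool) : l1 ++ true :: q <> l2 ++ false :: q.
Proof.
move=> eq12; have sz : size l1 = size l2.
  by have := congr1 size eq12; rewrite !size_cat => /addIn.
by move/eqP: eq12; rewrite eqseq_cat // => /andP[].
Qed.

(** Binders differ because bound variables are distinct, literals because their positions record
    different choices. *)
Lemma trees_disjoint G D (P1 : deriv G) (P2 : deriv D) q u :
    uniq (bvs G ++ bvs D) ->
    u \in cleaves (trees P1 (true :: q)) ->
    u \in cleaves (trees P2 (false :: q)) -> False.
Proof.
rewrite cat_uniq => /and3P[_ /hasPn dis _]; case: u => [[k x]|[p k]].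
  rewrite !trees_binder => /qvs_bvs xG /qvs_bvs xD.
  by have := dis _ xD; rewrite /= xG.
by case/trees_positions=> l1 -> /trees_positions[l2] /branches_neq.
Qed.

(** The rule f leaves the position unchanged, so its leaf could share its name with the leaf of an
    instance of t; the absence of [Fls] rules this out. *)
Lemma trees_uniq G (P : deriv G) q :
  all (@fls_free S) G -> uniq (bvs G) -> uniq (cleaves (trees P q)).
Proof.
elim: P q => {G} //=.
- by move=> a q _ _; rewrite andbT inE; apply/eqP => -[].
- move=> A B G P IH q; rewrite -andbA => fl.
  rewrite /bvs /= -catA => /(IH q fl).
  by case: (trees P q) => [|L [|R F]] //=; rewrite !cleaves_cons /= catA.
- move=> A B G D P1 IH1 P2 IH2 q.
  rewrite all_cat => /andP[/andP[fA fB] /andP[fG fD]].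
  rewrite uniq_bvs_And => u; have := u; rewrite cat_uniq => /and3P[u1 _ u2].
  have := @trees_disjoint _ _ P1 P2 q _ u.
  have := IH1 (true :: q) _ u1; have := IH2 (false :: q) _ u2.
  rewrite fA fB => /(_ fD) {}IH2 /(_ fG) {}IH1.
  case: (trees P1 _) (trees P2 _) IH1 IH2 => [|L E] [|R F] //= u1' u2' dis.
  suff : uniq (cleaves (L :: E) ++ cleaves (R :: F)).
    congr (is_true _); apply: perm_uniq.
    by rewrite !cleaves_cons cleaves_cat perm_catACA.
  rewrite cat_uniq u1' u2' andbT; apply/hasPn => v vF; apply/negP => vE.
  exact: dis vE vF.
- move=> G D P1 IH1 P2 IH2 q; rewrite all_cat bvs_cat => /andP[fG fD] u.
  have := u; rewrite cleaves_cat !cat_uniq => /and3P[u1 _ u2].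
  rewrite IH1 ?IH2 // andbT; apply/hasPn => v vF; apply/negP => vE.
  exact: (trees_disjoint u) vE vF.
- move=> x t A G fr P IH q; rewrite -(fls_free_instantiate x t) => fl.
  rewrite -[_ && _]/(uniq (x :: bvs (A :: G))) -(bvs_instantiate x t).
  case/andP=> xA /(IH q fl); have := trees_binder P q true x.
  case: (trees P q) => [|T F] // xF uF;
    rewrite -[uniq _]/((_ \notin cleaves (T :: F)) &&
      uniq (cleaves (T :: F))) uF.
  by rewrite andbT xF; apply: contra xA => /qvs_bvs.
- move=> x A G fr P IH q fl.
  rewrite -[_ && _]/(uniq (x :: bvs (A :: G))) => /andP[xA] /(IH q fl).
  have := trees_binder P q false x.
  case: (trees P q) => [|T F] // xF uF;
    rewrite -[uniq _]/((_ \notin cleaves (T :: F)) &&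
      uniq (cleaves (T :: F))) uF.
  by rewrite andbT xF; apply: contra xA => /qvs_bvs.
- move=> s G ps P IH q; rewrite all_exchange // bvs_exchange // => fl u.
  by rewrite (perm_uniq (perm_cleaves_exchange ps P q)); apply: IH.
Qed.

Lemma cleaves_cat_cons u c L R E F :
  (u \in cleaves (Join c L R :: E ++ F)) =
  (u \in cleaves (L :: E)) || (u \in cleaves (R :: F)).
Proof. by rewrite !cleaves_cons cleaves_cat /= !mem_cat orbACA. Qed.

Lemma trees_partner G (P : deriv G) q p b :
  inr (p, Some b) \in cleaves (trees P q) ->
  inr (p, Some (~~ b)) \in cleaves (trees P q).
Proof.
elim: P q => {G} //=.
- by move=> a q; rewrite !inE => /orP[] /eqP[-> ->]; rewrite eqxx ?orbT.
- move=> A B G P IH q; have := IH q.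
  by case: (trees P q) => [|L [|R F]] //=; rewrite !cleaves_cons /= catA.
- move=> A B G D P1 IH1 P2 IH2 q; have := (IH1 (true :: q), IH2 (false :: q)).
  case: (trees P1 _) (trees P2 _) => [|L E] [|R F] // [{}IH1 {}IH2].
  by rewrite !cleaves_cat_cons => /orP[/IH1|/IH2] ->; rewrite ?orbT.
- move=> G P IH q; rewrite !cleaves_cons !mem_cat !inE.
  by case/orP=> [/eqP[] //|/IH ->]; rewrite orbT.
- move=> G D P1 IH1 P2 IH2 q; rewrite !cleaves_cat !mem_cat.
  by case/orP=> [/IH1|/IH2] ->; rewrite ?orbT.
- move=> x t A G fr P IH q; have := IH q; case: (trees P q) => //.
- move=> x A G fr P IH q; have := IH q; case: (trees P q) => //.
- move=> s G ps P IH q; rewrite !(perm_mem (perm_cleaves_exchange ps P q)).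
  exact: IH.
Qed.

(* [r] is the renaming of the free variables of the conclusion: eigenvariables
   are fixed by it above the instance of [d_all] that introduces them, so the
   instances are those of the proof in which every variable occurring outside
   the scope of its eigenvariable condition is renamed by [r]. *)
Fixpoint renamed_instances G (P : deriv G) r : seq (var * term S) :=
  match P with
  | d_ax _ | d_tru => [::]
  | d_or _ _ _ P1 | d_fls _ P1 | d_exch _ _ _ P1 => renamed_instances P1 r
  | d_and _ _ _ _ P1 P2 | d_mix _ _ P1 P2 =>
      renamed_instances P1 r ++ renamed_instances P2 r
  | d_ex x t _ _ _ P1 => (x, subst_term r t) :: renamed_instances P1 r
  | d_all x _ _ _ P1 => renamed_instances P1 (upd r x (Var x))
  end.

(** The left atom of an axiom under the same renaming. [path] lists the choices from the root
    upwards, so it is a reversed position; [Tru] is the default for paths that reach no axiom. *)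
Fixpoint renamed_axiom G (P : deriv G) r (path : seq bool) : atom S :=
  match P with
  | d_ax a => subst_atom r a
  | d_tru => Tru
  | d_or _ _ _ P1 | d_fls _ P1 | d_exch _ _ _ P1 => renamed_axiom P1 r path
  | d_and _ _ _ _ P1 P2 | d_mix _ _ P1 P2 =>
      if path is b :: path' then
        if b then renamed_axiom P1 r path' else renamed_axiom P2 r path'
      else Tru
  | d_ex _ _ _ _ _ P1 => renamed_axiom P1 r path
  | d_all x _ _ _ P1 => renamed_axiom P1 (upd r x (Var x)) path
  end.

(** Stated for pointwise identities because [upd Var x (Var x)] is [Var] only pointwise. *)
Lemma renamed_instancesE G (P : deriv G) r :
  (forall x, r x = Var x) -> renamed_instances P r = ex_instances P.
Proof.
elim: P r => {G} //=.
- by move=> A B G D P1 IH1 P2 IH2 r rE; rewrite IH1 ?IH2.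
- by move=> G D P1 IH1 P2 IH2 r rE; rewrite IH1 ?IH2.
- move=> x t A G fr P IH r rE; rewrite IH //; congr ((_, _) :: _).
  by rewrite -[RHS]subst_term_Var; apply: eq_subst_term.
- by move=> x A G fr P IH r rE; apply: IH => y; rewrite /upd;
  case: eqP => [->|].
Qed.

(** The calculus is linear: each existential quantifier of the conclusion is introduced by exactly
    one instance. *)
Lemma renamed_instances_dom G (P : deriv G) r :
  perm_eq [seq e.1 | e <- renamed_instances P r] (qvs true G).
Proof.
elim: P r => {G} //=.
- by move=> A B G P IH r; rewrite (perm_trans (IH r)) // /qvs /= catA.
- move=> A B G D P1 IH1 P2 IH2 r; rewrite map_cat.
  rewrite (perm_trans (perm_cat (IH1 r) (IH2 r))) //.
  by rewrite /qvs /= map_cat flatten_cat perm_catACA.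
- move=> G D P1 IH1 P2 IH2 r; rewrite map_cat qvs_cat.
  exact: perm_cat.
- move=> x t A G fr P IH r; rewrite /qvs /= perm_cons.
  by rewrite (perm_trans (IH r)) // qvs_instantiate.
- move=> s G ps P IH r; rewrite (perm_trans (IH r)) //.
  by rewrite perm_sym; apply: perm_flatten_exchange.
Qed.

Lemma occurs_upd y r x t u : occurs_term y (upd r x t u) ->
  occurs_term y t \/ occurs_term y (r u).
Proof. by rewrite /upd; case: eqP; auto. Qed.

(** A variable of a renamed witness is either fixed as the eigenvariable of a universal rule below
    it, or produced by [r]. *)
Lemma occurs_renamed_instances G (P : deriv G) r d x y :
    agrees d (renamed_instances P r) -> x \in qvs true G ->
    occurs_term y (d x) ->
  y \in qvs false G \/ exists u, occurs_term y (r u).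
Proof.
elim: P r => {G} //=.
- by move=> A B G P IH r ag; have := IH r ag; rewrite /qvs /= !catA.
- move=> A B G D P1 IH1 P2 IH2 r /agrees_cat[ag1 ag2].
  rewrite !qvs_And => /orP[/(IH1 r ag1)|/(IH2 r ag2)] H /H [->|]; auto;
    by rewrite ?orbT; auto.
- move=> G D P1 IH1 P2 IH2 r /agrees_cat[ag1 ag2].
  rewrite !qvs_cat !mem_cat => /orP[/(IH1 r ag1)|/(IH2 r ag2)] H /H [->|]; auto;
    by rewrite ?orbT; auto.
- move=> z t A G fr P IH r [dz ag]; rewrite inE => /predU1P[->|].
    rewrite dz => /occurs_subst_term[u _ yu]; by right; exists u.
  by have := IH r ag; rewrite !qvs_instantiate.
- move=> z A G fr P IH r ag xG /(IH _ ag xG) [yG|[u /occurs_upd[/eqP->|]]].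
  + by left; rewrite /qvs /= inE; rewrite -/(qvs false (A :: G)) in yG *;
    rewrite yG orbT.
  + by left; rewrite /qvs /= mem_head.
  + by right; exists u.
- by move=> s G ps P IH r ag; rewrite !qvs_exchange //; apply: IH.
Qed.

(** An upper bound, on names, for the leap graph. It also relates a literal of an axiom to itself,
    which the irreflexivity of [e] in [no_bimatching] discards. *)
Definition leap_id d : rel node := fun u v =>
  match u, v with
  | inr (p, Some _), inr (q, Some _) => p == q
  | inl (true, x), inl (false, y) => occurs_term y (d x)
  | inl (false, y), inl (true, x) => occurs_term y (d x)
  | _, _ => false
  end.

Lemma leap_id_sym d : symmetric (leap_id d).
Proof. by move=> [[[] x]|[p [b|]]] [[[] y]|[q [c|]]] //=; rewrite eq_sym. Qed.

Lemma leap_id_split G D (P1 : deriv G) (P2 : deriv D) r d q u v :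
    uniq (bvs G ++ bvs D) ->
    (forall y w, y \in qvs false (G ++ D) -> ~~ occurs_term y (r w)) ->
    agrees d (renamed_instances P1 r) -> agrees d (renamed_instances P2 r) ->
    u \in cleaves (trees P1 (true :: q)) ->
    v \in cleaves (trees P2 (false :: q)) -> ~ leap_id d u v.
Proof.
rewrite cat_uniq qvs_cat => /and3P[_ /hasPn dis _] avoid ag1 ag2.
have avoid_r y : y \in qvs false G ++ qvs false D ->
    (exists u, occurs_term y (r u)) -> False.
  by move=> yGD [w]; apply/negP/avoid.
case: u v => [[[] x]|[p [b|]]] [[[] y]|[p' [b'|]]] //=.
- rewrite !trees_binder => xG yD /(occurs_renamed_instances ag1 xG) [/qvs_bvs
  yG|].
    by have := dis _ (qvs_bvs yD); rewrite /= yG.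
  by apply: avoid_r; rewrite mem_cat yD orbT.
- rewrite !trees_binder => xG yD /(occurs_renamed_instances ag2 yD) [/qvs_bvs
  xD|].
    by have := dis _ xD; rewrite /= (qvs_bvs xG).
  by apply: avoid_r; rewrite mem_cat xG.
- by case/trees_positions=> l1 -> /trees_positions[l2 ->] /eqP /branches_neq.
Qed.

(** The invariant is that [r] avoids all universal variables of the conclusion. Above a universal
    rule [r] fixes the eigenvariable, which by uniqueness is not bound in the premise. *)
Lemma trees_no_bimatching G (P : deriv G) r d q :
    all (@fls_free S) G -> uniq (bvs G) ->
    (forall y u, y \in qvs false G -> ~~ occurs_term y (r u)) ->
    agrees d (renamed_instances P r) ->
  no_bimatching (fedge (trees P q)) (leap_id d) (cleaves (trees P q)).
Proof.
elim: P r q => {G}.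
- move=> a r q _ _ _ _ e [|u W] _ _ _ _ _ mE _ //.
  by have [v []] := mE u (mem_head _ _).
- move=> A B G P IH r q /=; rewrite -andbA /bvs /qvs /= -!catA => fl u av ag.
  have := IH r q fl u av ag; have := trees_fits P q.
  case/pointwise_inv=> L [? [-> _]] /pointwise_inv[R [F [-> _ _]]].
  apply: eq_no_bimatching => [v w|v]; last by rewrite !cleaves_cons catA.
  by rewrite !fedge_cons /= orbF orbA.
- move=> A B G D P1 IH1 P2 IH2 r q fl u av /agrees_cat[ag1 ag2].
  have uF := trees_uniq (d_and P1 P2) q fl u; move: u fl => /=.
  rewrite uniq_bvs_And all_cat => u /andP[/andP[fA fB] /andP[fG fD]].
  have := u; rewrite cat_uniq => /and3P[u1 _ u2].
  have av1 y w : y \in qvs false (A :: G) -> ~~ occurs_term y (r w).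
    by move=> yG; apply: av; rewrite qvs_And yG.
  have av2 y w : y \in qvs false (B :: D) -> ~~ occurs_term y (r w).
    by move=> yD; apply: av; rewrite qvs_And yD orbT.
  have av12 y w : y \in qvs false ((A :: G) ++ (B :: D)) ->
      ~~ occurs_term y (r w).
    by rewrite qvs_cat mem_cat => /orP[/av1|/av2].
  have dis v := @trees_disjoint _ _ P1 P2 q v u.
  have spl v w := @leap_id_split _ _ P1 P2 r d q v w u av12 ag1 ag2.
  have {IH1} := IH1 r (true :: q) (introT andP (conj fA fG)) u1 av1 ag1.
  have {IH2} := IH2 r (false :: q) (introT andP (conj fB fD)) u2 av2 ag2.
  move: uF dis spl => /=;
    have := (trees_fits P1 (true :: q), trees_fits P2 (false :: q)).
  case=> /pointwise_inv[L [E [-> _ _]]] /pointwise_inv[R [F [-> _ _]]].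
  move=> uF dis spl nb2 nb1.
  apply: (@eq_no_bimatching _ (fedge (Join true L R :: E ++ F)) _ _
            (cleaves (L :: E) ++ cleaves (R :: F))) => // [v|].
    by rewrite mem_cat cleaves_cat_cons.
  apply: (forest_no_bimatching_sum (c := true) (L := leaves L) (M :=
    leaves R)) => //.
  + move=> v w; rewrite !fedge_cons fedge_cat /=; 
    by case: (cedge L v w) (cedge R v w) (fedge E v w) (fedge F v w) => [] []
      [] [];
       rewrite /= ?orbT ?orbF.
  + by move=> v vL; rewrite cleaves_cons mem_cat vL.
  + by move=> v vR; rewrite cleaves_cons mem_cat vR.
- by move=> r q _ _ _ _ e [|u W] _ _ _ _ _ mE _ //;
  have [v []] := mE u (mem_head _ _).
(* The rule f, whose conclusion contains [Fls]. *)
- by [].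
- move=> G D P1 IH1 P2 IH2 r q fl u av /agrees_cat[ag1 ag2].
  have uF := trees_uniq (d_mix P1 P2) q fl u; move: u fl => /=.
  rewrite bvs_cat all_cat => u /andP[fG fD].
  have := u; rewrite cat_uniq => /and3P[u1 _ u2].
  have av1 y w : y \in qvs false G -> ~~ occurs_term y (r w).
    by move=> yG; apply: av; rewrite qvs_cat mem_cat yG.
  have av2 y w : y \in qvs false D -> ~~ occurs_term y (r w).
    by move=> yD; apply: av; rewrite qvs_cat mem_cat yD orbT.
  rewrite cleaves_cat.
  apply: (forest_no_bimatching_sum (c := false) (L := [::]) (M := [::])) => //.
  + by move=> v w; rewrite fedge_cat orbF.
  + by move=> v; apply: (trees_disjoint u).
  + by move=> v w; apply: (leap_id_split u av ag1 ag2).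
  + exact: (IH1 r (true :: q) fG u1 av1 ag1).
  + exact: (IH2 r (false :: q) fD u2 av2 ag2).
- move=> x t A G fr P IH r q fl u av [dx ag].
  have avP y w : y \in qvs false (instantiate x t A :: G) ->
    ~~ occurs_term y (r w).
    by rewrite qvs_instantiate; apply: av.
  have uF := trees_uniq (d_ex fr P) q fl u.
  move: fl u; rewrite /= -(fls_free_instantiate x t) => fl.
  rewrite -[_ && _]/(uniq (x :: bvs (A :: G))) -(bvs_instantiate x t) =>
    /andP[xA u].
  have := IH r q fl u avP ag; have := fun k y => trees_binder P q k y.
  move: uF => /=; have := trees_fits P q; case/pointwise_inv=> T [F [-> _ _]].
  move=> uF TP nb.
  apply: (@no_bimatching_add _ (inl (true, x)) (fedge (T :: F))) => //.
  (* No leaps at the new binder: all variables of its witness are produced by [r], hence not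
     universal in the premise. *)
  + right=> -[[[] y]|p] //; rewrite TP => yA /=;
    rewrite dx => /occurs_subst_term.
    by case=> z _ yz; have := avP _ z yA; rewrite yz.
  + by rewrite fedge_irr.
  + move=> v w vF wF; rewrite !fedge_cons /= !inE.
    have neq z : z \in cleaves (T :: F) -> (z == inl (true, x)) = false.
      move=> zF; apply: contraTF zF => /eqP->; rewrite TP.
      by apply: contra xA => /qvs_bvs.
    by rewrite !neq //= andbF orbF.
- move=> x A G fr P IH r q fl u av ag.
  have uF := trees_uniq (d_all fr P) q fl u.
  move: fl u; rewrite /= => fl.
  rewrite -[_ && _]/(uniq (x :: bvs (A :: G))) => /andP[xA u].
  have avP y w : y \in qvs false (A :: G) -> ~~ occurs_term y (upd r x (Var x)
    w).
    move=> yA; apply/negP => /occurs_upd[/= /eqP yx|].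
      by move: yA; rewrite yx => /qvs_bvs; apply/negP.
    by apply/negP; apply: av;
      rewrite /qvs /= inE -/(qvs false (A :: G)) yA orbT.
  have := IH _ q fl u avP ag; have := fun k y => trees_binder P q k y.
  move: uF => /=; have := trees_fits P q; case/pointwise_inv=> T [F [-> _ _]].
  move=> uF TP nb.
  have neq z : z \in cleaves (T :: F) -> (z == inl (false, x)) = false.
    move=> zF; apply: contraTF zF => /eqP->; rewrite TP.
    by apply: contra xA => /qvs_bvs.
  apply: (@no_bimatching_add _ (inl (false, x)) (fedge (T :: F))) => //.
  + left=> v vF; rewrite fedge_cons /= orbF -fedge_cons =>
    /fedge_leaves/andP[/neq].
    by rewrite eqxx.
  + by rewrite fedge_irr.
  + by move=> v w vF wF; rewrite !fedge_cons /= orbF.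
- move=> s G ps P IH r q; rewrite all_exchange // bvs_exchange // => fl u av ag.
  apply: eq_no_bimatching (IH r q fl u _ ag) => [v w|v|y w yG].
  + by rewrite /= /fedge has_exchange // perm_trees.
  + by rewrite /= (perm_mem (perm_cleaves_exchange ps P q)).
  + by apply: av; rewrite qvs_exchange.
Qed.

End Proofs.

(** * Dualizers from proofs and the vertices of a formula *)

Section Realization.

Variable S : signature.
Implicit Types (A B : formula S) (G D : seq (formula S)) (T : cotree).
Implicit Types (s r d : subst S) (kappa : seq bool -> atom S).

(** [kappa] gives the left atom of the axiom at a position. *)
Definition leaf_atom kappa (v : seq bool * option bool) : atom S :=
  match v with
  | (_, None) => Tru
  | (p, Some b) => if b then dual (kappa p) else kappa p
  end.

(* The atoms of [A], instantiated by [d] on existential variables, by the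
   identity on universal variables and by [s] on free variables, are the atoms
   of the leaves they originate from. *)
Fixpoint realizes d kappa s A T : Prop :=
  match A, T with
  | Atom a, Leaf (inr v) => leaf_atom kappa v = subst_atom s a
  | And A B, Join _ L R | Or A B, Join _ L R =>
      realizes d kappa s A L /\ realizes d kappa s B R
  | Ex x A, Join _ _ R => realizes d kappa (upd s x (d x)) A R
  | All x A, Join _ _ R => realizes d kappa (upd s x (Var x)) A R
  | _, _ => False
  end.

Lemma eq_realizes d kappa s r A T : (forall z, free z A -> s z = r z) ->
  realizes d kappa s A T -> realizes d kappa r A T.
Proof.
elim: A s r T => [a|A IHA B IHB|A IHA B IHB|x A IHA|x A IHA] s r [v|c L R]
  //= sr.
- by case: v => // v ->; apply: eq_subst_atom.
- case=> rA rB; split.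
    by apply: IHA rA => z zA; apply: sr; rewrite zA.
  by apply: IHB rB => z zB; apply: sr; rewrite zB orbT.
- case=> rA rB; split.
    by apply: IHA rA => z zA; apply: sr; rewrite zA.
  by apply: IHB rB => z zB; apply: sr; rewrite zB orbT.
- by apply: IHA => z zA; rewrite /upd; case: eqP => // zx; apply: sr;
  rewrite zA andbT; apply/eqP.
- by apply: IHA => z zA; rewrite /upd; case: eqP => // zx; apply: sr;
  rewrite zA andbT; apply/eqP.
Qed.

Lemma free_for_notin x t A : ~~ free x A -> free_for x t A.
Proof.
elim: A => //= [A IHA B IHB|A IHA B IHB|y A IHA|y A IHA].
- by rewrite negb_or => /andP[/IHA-> /IHB].
- by rewrite negb_or => /andP[/IHA-> /IHB].
- by rewrite negb_and negbK => ->.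
- by rewrite negb_and negbK => ->.
Qed.

(** The passage of the substitution lemma below a quantifier on [y]: by [free_for], [y] does not
    occur in [t] when [x] is free in [A], so the update at [y] leaves the value of [t] alone. *)
Lemma upd_subst1 s r x y t u A :
    y != x -> (x == y) || ~~ free x A || ~~ occurs_term y t && free_for x t A ->
    (forall z, (z != y) && free z A -> r z = subst_term s (subst1 x t z)) ->
  forall z, free z A -> upd r y u z = subst_term (upd s y u) (subst1 x t z).
Proof.
move=> yx ff rs z zA; rewrite /upd /=; case: eqP => [->|/eqP zy].
  by rewrite /subst1 (negPf yx) /= eqxx.
rewrite rs ?zy //; apply: eq_subst_term => w; rewrite /subst1;
  case: eqP => [zx|_] /=.
  rewrite -zx eq_sym zx (negPf yx) /= -zx zA /= in ff.
  by case/andP: ff => yt _ wt; case: eqP => // wy; rewrite -wy wt in yt.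
by move/eqP->; rewrite (negPf zy).
Qed.

Lemma realizes_instantiate d kappa s r x t A T :
    free_for x t A ->
    (forall z, free z A -> r z = subst_term s (subst1 x t z)) ->
  realizes d kappa s (instantiate x t A) T -> realizes d kappa r A T.
Proof.
(* A quantifier on [x] itself, where [instantiate] stops. *)
have same y u B T' s' r' : y = x ->
    (forall z, (z != y) && free z B -> r' z = subst_term s' (subst1 x t z)) ->
    realizes d kappa (upd s' y u) B T' -> realizes d kappa (upd r' y u) B T'.
  move=> -> rs; apply: eq_realizes => z zB; rewrite /upd;
    case: eqP => // /eqP zx.
  by rewrite rs ?zx // /subst1 (negPf zx).
elim: A s r T => [a|A IHA B IHB|A IHA B IHB|y A IHA|y A IHA] s r [v|c L R]
  //= ff rs.
- case: v => // v ->; rewrite subst_atom_comp; apply: eq_subst_atom => z zA.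
  by rewrite rs.
- case/andP: ff => fA fB [rA rB]; split.
    by apply: IHA rA => // z zA; apply: rs; rewrite zA.
  by apply: IHB rB => // z zB; apply: rs; rewrite zB orbT.
- case/andP: ff => fA fB [rA rB]; split.
    by apply: IHA rA => // z zA; apply: rs; rewrite zA.
  by apply: IHB rB => // z zB; apply: rs; rewrite zB orbT.
- case: eqP => [yx|/eqP yx]; first exact: same.
  apply: IHA; last by apply: upd_subst1 => //.
  have [xA|/free_for_notin->//] := boolP (free x A).
  by move: ff; rewrite eq_sym (negPf yx) xA /= => /andP[].
- case: eqP => [yx|/eqP yx]; first exact: same.
  apply: IHA; last by apply: upd_subst1 => //.
  have [xA|/free_for_notin->//] := boolP (free x A).
  by move: ff; rewrite eq_sym (negPf yx) xA /= => /andP[].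
Qed.

(** At an existential rule [agrees] makes [d x] the renamed witness, so the substitution lemma turns
    a realization of the instance into one of the quantified formula. *)
Lemma trees_realize G (P : deriv G) r d kappa q :
    all (@fls_free S) G -> agrees d (renamed_instances P r) ->
    (forall l, kappa (l ++ q) = renamed_axiom P r (rev l)) ->
  pointwise (realizes d kappa r) G (trees P q).
Proof.
elim: P r q => {G} /=.
- move=> a r q _ _ kE; have := kE [::]; rewrite /= => kq.
  by do 2![apply: pointwise_cons => //=]; rewrite kq // subst_atom_dual.
- move=> A B G P IH r q; rewrite -andbA => fl ag kE.
  case/pointwise_inv: (IH r q fl ag kE) => L [? [-> rL]].
  by case/pointwise_inv=> R [F [-> rR rF]]; apply: pointwise_cons.
- move=> A B G D P1 IH1 P2 IH2 r q.
  rewrite all_cat => /andP[/andP[fA fB] /andP[fG fD]] /agrees_cat[ag1 ag2] kE.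
  have kE1 l : kappa (l ++ true :: q) = renamed_axiom P1 r (rev l).
    by rewrite -cat_rcons kE rev_rcons.
  have kE2 l : kappa (l ++ false :: q) = renamed_axiom P2 r (rev l).
    by rewrite -cat_rcons kE rev_rcons.
  case/pointwise_inv: (IH1 r _ (introT andP (conj fA fG)) ag1 kE1) => L [E [->
    rL rE]].
  case/pointwise_inv: (IH2 r _ (introT andP (conj fB fD)) ag2 kE2) => R [F [->
    rR rF]].
  by apply: pointwise_cons => //; apply: pointwise_cat.
- by move=> r q _ _ _; apply: pointwise_cons.
- by [].
- move=> G D P1 IH1 P2 IH2 r q.
  rewrite all_cat => /andP[fG fD] /agrees_cat[ag1 ag2] kE.
  apply: pointwise_cat; [apply: IH1 => // l|apply: IH2 => // l];
    by rewrite -cat_rcons kE rev_rcons.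
- move=> x t A G ff P IH r q fl [dx ag] kE; move: fl.
  rewrite -(fls_free_instantiate x t) => fl.
  case/pointwise_inv: (IH r q fl ag kE) => T [F [-> rT rF]].
  apply: pointwise_cons => //=; apply: realizes_instantiate ff _ rT => z _.
  by rewrite /upd /subst1; case: eqP.
- move=> x A G xG P IH r q fl ag kE.
  case/pointwise_inv: (IH _ q fl ag kE) => T [F [-> rT rF]].
  (* By the eigenvariable condition the side formulas do not notice that [x] was reset. *)
  apply: pointwise_cons => //=; apply: pointwise_impl rF => i lti.
  apply: eq_realizes => z zA; rewrite /upd; case: eqP => // zx.
  by have := all_nthP (Atom Fls) xG i lti; rewrite -zx zA.
- move=> s G ps P IH r q; rewrite all_exchange // => fl ag kE.
  by apply: pointwise_exchange => //; apply: IH.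
Qed.

(** The name of a vertex. If [T] fits [A] and has distinct leaves, this is an isomorphism from
    [graph A] onto the cograph of [T]; other shapes get a dummy. *)
Fixpoint place A T : graph A -> node :=
  match A return graph A -> node with
  | Atom _ => fun=> if T is Leaf v then v else inl (true, 0)
  | And A B => fun v : vertex (graph A) + vertex (graph B) =>
      if T is Join _ L R then
        match v with inl u => place L u | inr u => place R u end
      else inl (true, 0)
  | Or A B => fun v : vertex (graph A) + vertex (graph B) =>
      if T is Join _ L R then
        match v with inl u => place L u | inr u => place R u end
      else inl (true, 0)
  | Ex x A => fun v : unit + vertex (graph A) =>
      if T is Join _ _ R then if v is inr u then place R u else inl (true, x)
      else inl (true, 0)
  | All x A => fun v : unit + vertex (graph A) =>
      if T is Join _ _ R then if v is inr u then place R u else inl (false, x)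
      else inl (true, 0)
  end.

Lemma place_leaves A T (v : graph A) : fits A T -> place T v \in leaves T.
Proof.
elim: A T v => [a|A IHA B IHB|A IHA B IHB|x A IHA|x A IHA] [u|[] L R] //=.
- by move=> _; rewrite mem_head.
- by case=> v /andP[fA fB]; rewrite mem_cat ?IHA ?IHB ?orbT.
- by case=> v /andP[fA fB]; rewrite mem_cat ?IHA ?IHB ?orbT.
- by case: L => // u [[]|v] /andP[/eqP-> fA]; rewrite inE ?eqxx ?IHA ?orbT.
- by case: L => // u [[]|v] /andP[/eqP-> fA]; rewrite inE ?eqxx ?IHA ?orbT.
Qed.

Lemma place_onto A T u : fits A T -> u \in leaves T ->
  exists v : graph A, place T v = u.
Proof.
elim: A T => [a|A IHA B IHB|A IHA B IHB|x A IHA|x A IHA] [w|[] L R] //=.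
- by move=> _; rewrite inE => /eqP->; exists tt.
- case/andP=> fA fB; rewrite mem_cat => /orP[/(IHA _ fA)|/(IHB _ fB)] [v <-].
    by exists (inl v).
  by exists (inr v).
- case/andP=> fA fB; rewrite mem_cat => /orP[/(IHA _ fA)|/(IHB _ fB)] [v <-].
    by exists (inl v).
  by exists (inr v).
- case: L => // w /andP[/eqP-> fA]; rewrite inE => /predU1P[->|].
    by exists (inl tt).
  by case/(IHA _ fA)=> v <-; exists (inr v).
- case: L => // w /andP[/eqP-> fA]; rewrite inE => /predU1P[->|].
    by exists (inl tt).
  by case/(IHA _ fA)=> v <-; exists (inr v).
Qed.

Lemma place_inj A T : fits A T -> uniq (leaves T) -> injective (@place A T).
Proof.
elim: A T => [a|A IHA B IHB|A IHA B IHB|x A IHA|x A IHA] [w|[] L R] //=.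
- by move=> _ _ [] [].
- case/andP=> fA fB; rewrite cat_uniq => /and3P[uL /hasPn dis uR].
  case=> v [] w E; rewrite ?(IHA L fA uL _ _ E) ?(IHB R fB uR _ _ E) //.
    by have := dis _ (place_leaves w fB); rewrite /= -E place_leaves.
  by have := dis _ (place_leaves v fB); rewrite /= E place_leaves.
- case/andP=> fA fB; rewrite cat_uniq => /and3P[uL /hasPn dis uR].
  case=> v [] w E; rewrite ?(IHA L fA uL _ _ E) ?(IHB R fB uR _ _ E) //.
    by have := dis _ (place_leaves w fB); rewrite /= -E place_leaves.
  by have := dis _ (place_leaves v fB); rewrite /= E place_leaves.
- case: L => // u /andP[/eqP-> fA] /= /andP[xR uR] [[]|v] [[]|w] // E.
  + by rewrite E place_leaves in xR.
  + by rewrite -E place_leaves in xR.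
  + by rewrite (IHA R fA uR _ _ E).
- case: L => // u /andP[/eqP-> fA] /= /andP[xR uR] [[]|v] [[]|w] // E.
  + by rewrite E place_leaves in xR.
  + by rewrite -E place_leaves in xR.
  + by rewrite (IHA R fA uR _ _ E).
Qed.

Lemma cedge_disjoint c L R u v : uniq (leaves (Join c L R)) ->
  cedge (Join c L R) u v =
    if u \in leaves L then if v \in leaves L then cedge L u v else c &&
      (v \in leaves R)
    else if v \in leaves L then c && (u \in leaves R) else cedge R u v.
Proof.
rewrite /= cat_uniq => /and3P[_ /hasPn dis _].
have disf w : w \in leaves L -> (w \in leaves R) = false.
  by move=> wL; apply: contraTF wL => /dis.
have cL a b : (a \in leaves L) && (b \in leaves L) = false ->
  cedge L a b = false.
  by move=> ab; apply: contraFF ab => /cedge_leaves.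
have cR a b : (a \in leaves R) && (b \in leaves R) = false ->
  cedge R a b = false.
  by move=> ab; apply: contraFF ab => /cedge_leaves.
case: ifP => uL; case: ifP => vL.
- by rewrite (cR u v) (disf u) ?(disf v) ?uL //= !andbF !orbF.
- by rewrite (cL u v) ?vL ?andbF // (cR u v) ?(disf u) //= orbF.
- by rewrite (cL u v) ?uL // (cR u v) ?(disf v) ?andbF //= andbT.
- by rewrite (cL u v) ?uL //= !andbF orbF.
Qed.

Lemma place_edge A T (v w : graph A) : fits A T -> uniq (leaves T) ->
  edge v w = cedge T (place T v) (place T w).
Proof.
have notL (C : formula S) L R (u : graph C) : uniq (leaves L ++ leaves R) ->
    fits C R -> (place R u \in leaves L) = false.
  rewrite cat_uniq => /and3P[_ /hasPn dis _] fC.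
  by apply: contraNF (dis _ (place_leaves u fC)).
elim: A T v w => [a|A IHA B IHB|A IHA B IHB|x A IHA|x A IHA] [z|c L R] v w //.
- rewrite [fits _ _]/=; case: c => // /andP[fA fB] uT.
  rewrite cedge_disjoint //; have := uT; rewrite /= cat_uniq => /and3P[uL _ uR].
  have inL u := place_leaves u fA; have inR u := place_leaves u fB.
  have outR (u : graph B) := notL B L R u uT fB.
  by case: v w => v [] w /=; rewrite ?inL ?inR ?outR //;
    [apply: IHA|apply: IHB].
- rewrite [fits _ _]/=; case: c => // /andP[fA fB] uT.
  rewrite cedge_disjoint //; have := uT; rewrite /= cat_uniq => /and3P[uL _ uR].
  have inL u := place_leaves u fA; have inR u := place_leaves u fB.
  have outR (u : graph B) := notL B L R u uT fB.
  by case: v w => v [] w /=; rewrite ?inL ?inR ?outR //;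
    [apply: IHA|apply: IHB].
- rewrite [fits _ _]/=; case: c => //; case: L => // y /andP[/eqP-> fA] uT.
  rewrite cedge_disjoint //; have := uT; rewrite /= => /andP[_ uR].
  have inR u := place_leaves u fA.
  have outR (u : graph A) := notL A (Leaf _) R u uT fA.
  by case: v w => [[]|v] [[]|w] /=; rewrite /= ?outR ?mem_head ?inR //;
    apply: IHA.
- rewrite [fits _ _]/=; case: c => //; case: L => // y /andP[/eqP-> fA] uT.
  rewrite cedge_disjoint //; have := uT; rewrite /= => /andP[_ uR].
  have inR u := place_leaves u fA.
  have outR (u : graph A) := notL A (Leaf _) R u uT fA.
  by case: v w => [[]|v] [[]|w] /=; rewrite /= ?outR ?mem_head ?inR //;
    apply: IHA.
Qed.

Lemma size_cotree_origins A T : fits A T -> size (cotree_origins T) = natoms A.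
Proof.
elim: A T => [a|A IHA B IHB|A IHA B IHB|x A IHA|x A IHA] [[//|v]|[] L R] //=.
- by case/andP=> fA fB; rewrite size_cat IHA ?IHB.
- by case/andP=> fA fB; rewrite size_cat IHA ?IHB.
- by case: L => // u /andP[/eqP-> fA]; rewrite IHA.
- by case: L => // u /andP[/eqP-> fA]; rewrite IHA.
Qed.

Lemma atom_index_lt A (v : graph A) i : atom_index v = Some i -> i < natoms A.
Proof.
elim: A v i => [a|A IHA B IHB|A IHA B IHB|x A IHA|x A IHA] v i /=.
- by case=> <-.
- case: v => v; first by move/IHA => lt; rewrite ltn_addr.
  by case E: (atom_index v) => [j|] //= [<-]; rewrite ltn_add2l (IHB _ _ E).
- case: v => v; first by move/IHA => lt; rewrite ltn_addr.
  by case E: (atom_index v) => [j|] //= [<-]; rewrite ltn_add2l (IHB _ _ E).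
- by case: v => // v; apply: IHA.
- by case: v => // v; apply: IHA.
Qed.

(** Both sides count literals from left to right: the offset of a right summand skips exactly the
    origins of the left one. *)
Lemma place_origin A T (v : graph A) : fits A T ->
  obind (nth None (cotree_origins T)) (atom_index v) = node_origin (place T v).
Proof.
have sumE B C L R (u : graph B + graph C) : fits B L -> fits C R ->
    (forall w : graph B, obind (nth None (cotree_origins L)) (atom_index w) =
       node_origin (place L w)) ->
    (forall w : graph C, obind (nth None (cotree_origins R)) (atom_index w) =
       node_origin (place R w)) ->
    obind (nth None (cotree_origins L ++ cotree_origins R))
      (match u with
       | inl w => atom_index w
       | inr w => omap (addn (natoms B)) (atom_index w)
       end) =
    node_origin match u with inl w => place L w | inr w => place R w end.
  move=> fB fC LE RE; case: u => w.
    rewrite -LE; case E: (atom_index w) => [i|] //=.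
    by rewrite nth_cat (size_cotree_origins fB) (atom_index_lt E).
  rewrite -RE; case E: (atom_index w) => [i|] //=.
  by rewrite nth_cat (size_cotree_origins fB) ltnNge leq_addr addKn.
elim: A T v => [a|A IHA B IHB|A IHA B IHB|x A IHA|x A IHA] [[//|z]|c L R] v //=.
- by case: c => // /andP[fA fB]; apply: sumE => // w; [apply: IHA|apply: IHB].
- by case: c => // /andP[fA fB]; apply: sumE => // w; [apply: IHA|apply: IHB].
- case: c => //; case: L => // y /andP[/eqP-> fA].
  by case: v => [[]|v] //=; apply: IHA.
- case: c => //; case: L => // y /andP[/eqP-> fA].
  by case: v => [[]|v] //=; apply: IHA.
Qed.

Lemma place_binder A T (v : graph A) x : fits A T -> lab v = Bnd x ->
  exists2 k, place T v = inl (k, x) & x \in qvars k A.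
Proof.
elim: A T v => [a|A IHA B IHB|A IHA B IHB|y A IHA|y A IHA] [z|[] L R] v //=.
- case/andP=> fA fB; case: v => v /=.
    by case/(IHA _ _ fA)=> k -> xA; exists k; rewrite // mem_cat xA.
  by case/(IHB _ _ fB)=> k -> xB; exists k; rewrite // mem_cat xB orbT.
- case/andP=> fA fB; case: v => v /=.
    by case/(IHA _ _ fA)=> k -> xA; exists k; rewrite // mem_cat xA.
  by case/(IHB _ _ fB)=> k -> xB; exists k; rewrite // mem_cat xB orbT.
- case: L => // w /andP[_ fA]; case: v => [[] [->]|v] /=.
    by exists true; rewrite ?mem_head.
  by case/(IHA _ _ fA)=> k -> xA; exists k; rewrite // mem_cat xA orbT.
- case: L => // w /andP[_ fA]; case: v => [[] [->]|v] /=.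
    by exists false; rewrite ?mem_head.
  by case/(IHA _ _ fA)=> k -> xA; exists k; rewrite // mem_cat xA orbT.
Qed.

(** The updates in [realizes] agree with [d]: by definition at an existential variable, and because
    [d] fixes the universal ones. *)
Lemma place_literal A T (v : graph A) a d kappa s :
    fits A T -> realizes d kappa s A T -> (forall z, free z A -> s z = d z) ->
    (forall y, y \in qvars false A -> d y = Var y) -> lab v = Lit a ->
  exists2 p, place T v = inr p & leaf_atom kappa p = subst_atom d a.
Proof.
elim: A T v s => [b|A IHA B IHB|A IHA B IHB|y A IHA|y A IHA] [[//|z]|[] L R]
  v s //=.
- by move=> _ rz sd _ [<-]; exists z; rewrite ?rz //; apply: eq_subst_atom.
- case/andP=> fA fB [rA rB] sd dy; case: v => v /= lv.
    apply: (IHA _ _ s) => // z zA; first by apply: sd; rewrite zA.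
    by apply: dy; rewrite mem_cat zA.
  apply: (IHB _ _ s) => // z zB; first by apply: sd; rewrite zB orbT.
  by apply: dy; rewrite mem_cat zB orbT.
- case/andP=> fA fB [rA rB] sd dy; case: v => v /= lv.
    apply: (IHA _ _ s) => // z zA; first by apply: sd; rewrite zA.
    by apply: dy; rewrite mem_cat zA.
  apply: (IHB _ _ s) => // z zB; first by apply: sd; rewrite zB orbT.
  by apply: dy; rewrite mem_cat zB orbT.
- case: L => // w /andP[_ fA] rA sd dy; case: v => [[//]|v] lv.
  apply: IHA rA _ dy lv => // z zA; rewrite /upd; case: eqP => [->//|/eqP zy].
  by apply: sd; rewrite zy.
- case: L => // w /andP[_ fA] rA sd dy; case: v => [[//]|v] lv.
  apply: IHA rA _ _ lv => // [z zA|z zA]; last by apply: dy;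
    rewrite inE zA orbT.
  rewrite /upd; case: eqP => [->|/eqP zy]; first by rewrite dy // mem_head.
  by apply: sd; rewrite zy.
Qed.

End Realization.

(** * Scopes of binders *)

Section Modules.

Variables (S : signature) (G : lgraph S).
Implicit Types (M N X Y : {set G}) (b u v w z : G).

Lemma moduleP M : module M <->
  forall u v w, u \in M -> v \in M -> w \notin M -> edge u w = edge v w.
Proof.
split=> [mM u v w uM vM wM|mM u v uM vM].
  by have /setP/(_ w) := mM u v uM vM; rewrite !inE wM.
by apply/setP => w; rewrite !inE; case: (boolP (w \in M)) => //= wM; apply: mM.
Qed.

(** Boolean forms, for choosing maximal and minimal sets. *)
Definition moduleb M :=
  [forall u in M, forall v in M, neighbours u :\: M == neighbours v :\: M].

Lemma modulebP M : reflect (module M) (moduleb M).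
Proof.
apply: (iffP 'forall_in_'forall_in_eqP) => mM; last by move=> u uM v vM;
  apply: mM.
by move=> u v uM vM; apply: mM.
Qed.

Definition strongb M :=
  moduleb M &&
  [forall N, moduleb N ==> [|| M \subset N, N \subset M | [disjoint M & N]]].

Lemma strongbP M : reflect (strong M) (strongb M).
Proof.
apply: (iffP andP) => [[/modulebP mM /forallP sM]|[mM sM]]; split=> //.
- by move=> N /modulebP mN; apply/or3P; have := sM N; rewrite mN.
- exact/modulebP.
- by apply/forallP => N; apply/implyP => /modulebP /sM /or3P.
Qed.

(** From outside the union, all its vertices look like the common vertex [z]. *)
Lemma module_setU M N z : module M -> module N -> z \in M -> z \in N ->
  module (M :|: N).
Proof.
move=> /moduleP mM /moduleP mN zM zN.
suff mz u w : u \in M :|: N -> w \notin M :|: N -> edge u w = edge z w.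
  by apply/moduleP => u v w uU vU wU; rewrite !mz.
rewrite !inE negb_or => /orP[uM|uN] /andP[wM wN]; first exact: mM.
exact: mN.
Qed.

(* The largest module in which [b] is adjacent to all other vertices (to none,
   if [k] is [false]) is strong: together with a module overlapping it, it
   would form a larger one. *)
Lemma scope_binder k b X :
    b \notin X -> X != set0 -> module X -> module (b |: X) ->
    (forall u, u \in X -> edge b u = k) ->
  exists M, [/\ scope b M, X \subset M &
                forall v, v \in M -> v != b -> edge b v = k].
Proof.
move=> bX /set0Pn[x xX] mX mbX Xk.
pose homogeneous N :=
  [&& moduleb N, b \in N & [forall v in N, (v != b) ==> (edge b v == k)]].
have [|N /maxsetP[/and3P[/modulebP mN bN /forall_inP Nk] maxN] sN] :=
    @maxset_exists _ homogeneous (b |: X).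
  rewrite /homogeneous setU11 (introT (modulebP _)) //=.
  apply/forall_inP => v; rewrite !inE => /predU1P[->|vX]; first by rewrite eqxx.
  by rewrite Xk // eqxx implybT.
have {}Nk v : v \in N -> v != b -> edge b v = k.
  by move=> vN vb; have := Nk v vN; rewrite vb => /eqP.
have strongN : strong N.
  split=> // Y mY; have [|NY] := boolP (N \subset Y); first by constructor 1.
  have [|YN] := boolP (Y \subset N); first by constructor 2.
  have [|] := boolP [disjoint N & Y]; first by constructor 3.
  rewrite -setI_eq0 => /set0Pn[z]; rewrite inE => /andP[zN zY].
  case/subsetPn: NY => u uN uY; case/negP: YN.
  suff hom : homogeneous (N :|: Y) by rewrite -(maxN _ hom (subsetUl _ _))
    subsetUr.
  rewrite /homogeneous inE bN (introT (modulebP _)) /=;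
    last exact: module_setU mN mY zN zY.
  apply/forall_inP => v vU; apply/implyP => vb; apply/eqP.
  have [vN|vN] := boolP (v \in N); first exact: Nk.
  have vY : v \in Y by move: vU; rewrite inE (negPf vN).
  (* If [b] is in [Y], then [b v] agrees with [u v] because [N] is a module, and [u v] with [u b]
     because [Y] is. Otherwise [b] sees [v] as it sees [z]. *)
  have [bY|bY] := boolP (b \in Y).
    have ub : u != b by apply: contraNneq uY => ->.
    rewrite -(Nk u uN ub) (proj1 (moduleP N) mN b u v) // edge_sym.
    exact: (proj1 (moduleP Y) mY).
  have zb : z != b by apply: contraNneq bY => <-.
  rewrite -(Nk z zN zb) edge_sym [RHS]edge_sym.
  exact: (proj1 (moduleP Y) mY).
(* A minimal candidate is the smallest one: strong modules sharing [b] are comparable. *)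
pose candidate M := [&& strongb M, 2 <= #|M| & b \in M].
have xb : x != b by apply: contraNneq bX => <-.
have [|M /minsetP[/and3P[/strongbP sM M2 bM] minM] MN] :=
    @minset_exists _ candidate N.
  rewrite /candidate (introT (strongbP _)) // bN andbT.
  rewrite (cardD1 b) bN (cardD1 x) !inE xb.
  by rewrite (subsetP sN) // inE xX orbT.
exists M; split.
- split=> // Y [sY Y2] bY; case: (sM.2 Y sY.1) => //; last first.
    by rewrite -setI_eq0 => /eqP/setP/(_ b); rewrite !inE bM bY.
  by move/minM => -> //; rewrite /candidate Y2 bY !andbT; apply/strongbP.
(* If [M] missed [X], comparing it with the module [b |: X] would leave only [b] in [M]. *)
- case: (sM.2 X mX) => //; first by move/subsetP/(_ b bM); rewrite (negPf bX).
  rewrite -setI_eq0 => /eqP MX0; case: (sM.2 _ mbX).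
  + move=> /subsetP MbX; move: M2; rewrite (cardD1 b) bM.
    rewrite (eq_card0 (A := [predD1 M & b])) // => v; rewrite !inE.
    apply/negP => /andP[vb vM]; have := MbX v vM;
      rewrite !inE (negPf vb) /= => vX.
    by have /setP/(_ v) := MX0; rewrite !inE vM vX.
  + by rewrite subUset => /andP[].
  + by rewrite -setI_eq0 => /eqP/setP/(_ b); rewrite !inE bM eqxx.
- by move=> v vM; apply: Nk; apply: (subsetP MN).
Qed.

Lemma scope_uniq b M N : scope b M -> scope b N -> M = N.
Proof.
move=> [pM bM minM] [pN bN minN]; apply/eqP; rewrite eqEsubset.
by rewrite minM ?minN.
Qed.

End Modules.

(** * Modules of a sum of graphs *)

Section Summands.

Variables (S : signature) (c : bool) (G H : lgraph S).
Let inG (u : G) : sum_graph c G H := inl u.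
Let inH (u : H) : sum_graph c G H := inr u.

Lemma inG_inj : injective inG. Proof. by move=> u v []. Qed.
Lemma inH_inj : injective inH. Proof. by move=> u v []. Qed.

(** All vertices of one summand see the other summand alike. *)
Lemma module_inl (X : {set G}) : module X -> module (inG @: X).
Proof.
move=> /moduleP mX; apply/moduleP => u v w /imsetP[a aX ->] /imsetP[b bX ->].
by case: w => w //=; rewrite (mem_imset _ _ inG_inj); apply: mX.
Qed.

Lemma module_inr (X : {set H}) : module X -> module (inH @: X).
Proof.
move=> /moduleP mX; apply/moduleP => u v w /imsetP[a aX ->] /imsetP[b bX ->].
by case: w => w //=; rewrite (mem_imset _ _ inH_inj); apply: mX.
Qed.

End Summands.

(** * The subgraph below a quantifier *)

Section Binders.

Variable S : signature.
Implicit Types (A B : formula S).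

Lemma cograph_sum c (G H : lgraph S) :
  cograph G -> cograph H -> cograph (sum_graph c G H).
Proof.
move=> cG cH [u|u] [v|v] [w|w] [z|z] /=;
  by first [exact: cG | exact: cH | case: c; rewrite ?orbT].
Qed.

Lemma cograph_single (l : label S) : cograph (single l).
Proof. by []. Qed.

Lemma graph_cograph A : cograph (graph A).
Proof.
by elim: A => *; do ?[apply: cograph_sum => //]; apply: cograph_single.
Qed.

Lemma graph_literal A : exists v : graph A, literal v.
Proof.
elim: A => [a|A [v lv] B _|A [v lv] B _|x A [v lv]|x A [v lv]].
- by exists tt, a.
- by exists (inl v).
- by exists (inl v).
- by exists (inr v).
- by exists (inr v).
Qed.

(** What [scope_binder] asks of [X], and a literal for the legality of [b]. The intended [X] is the
    graph of the quantified formula. *)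
Definition body (k : bool) (G : lgraph S) (b : G) (X : {set G}) : Prop :=
  [/\ b \notin X, module X, module (b |: X), forall u, u \in X -> edge b u = k &
      exists2 u, u \in X & literal u].

Lemma body_inl k c (G H : lgraph S) (b : G) X : body k b X ->
  exists Y, body k (inl b : sum_graph c G H) Y.
Proof.
case=> bX mX mbX Xk [u uX lu].
pose inG (v : G) : sum_graph c G H := inl v.
exists (inG @: X); split.
- by rewrite (mem_imset _ _ (@inG_inj _ c G H)).
- exact: module_inl.
- by rewrite -(imsetU1 inG); apply: module_inl.
- by move=> _ /imsetP[v vX ->]; apply: Xk.
- by exists (inG u); [apply: imset_f|].
Qed.

Lemma body_inr k c (G H : lgraph S) (b : H) X : body k b X ->
  exists Y, body k (inr b : sum_graph c G H) Y.
Proof.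
case=> bX mX mbX Xk [u uX lu].
pose inH (v : H) : sum_graph c G H := inr v.
exists (inH @: X); split.
- by rewrite (mem_imset _ _ (@inH_inj _ c G H)).
- exact: module_inr.
- by rewrite -(imsetU1 inH); apply: module_inr.
- by move=> _ /imsetP[v vX ->]; apply: Xk.
- by exists (inH u); [apply: imset_f|].
Qed.

Lemma module_setT (G : lgraph S) : module [set: G].
Proof. by apply/moduleP => u v w _ _; rewrite inE. Qed.

Lemma body_quantifier k l A :
  exists X, body k (inl tt : sum_graph k (single l) (graph A)) X.
Proof.
pose inA (v : graph A) : sum_graph k (single l) (graph A) := inr v.
have [u lu] := graph_literal A.
have E : (inl tt : sum_graph k (single l) (graph A)) |: inA @: [set: graph A]
  = setT.
  by apply/setP => -[[]|v]; rewrite !inE ?eqxx // (imset_f inA) ?orbT ?inE.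
exists (inA @: setT); split.
- by apply/imsetP => -[].
- exact/module_inr/module_setT.
- by rewrite E; apply: module_setT.
- by move=> _ /imsetP[v _ ->].
- by exists (inA u) => //; apply: imset_f; rewrite inE.
Qed.

Lemma binder_body A T (v : graph A) k x : fits A T ->
  place T v = inl (k, x) -> exists X, body k v X.
Proof.
elim: A T v => [a|A IHA B IHB|A IHA B IHB|y A IHA|y A IHA] [z|[] L R] v //=.
- by case: z => // p _.
- case/andP=> fA fB; case: v => v pv.
    by have [X] := IHA _ _ fA pv; apply: body_inl.
  by have [X] := IHB _ _ fB pv; apply: body_inr.
- case/andP=> fA fB; case: v => v pv.
    by have [X] := IHA _ _ fA pv; apply: body_inl.
  by have [X] := IHB _ _ fB pv; apply: body_inr.
- case: L => // w /andP[_ fA]; case: v => [[] [<- _]|v pv].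
    exact: body_quantifier.
  by have [X] := IHA _ _ fA pv; apply: (@body_inr _ true (single _)).
- case: L => // w /andP[_ fA]; case: v => [[] [<- _]|v pv].
    exact: body_quantifier.
  by have [X] := IHA _ _ fA pv; apply: (@body_inr _ false (single _)).
Qed.

End Binders.

Lemma place_lab S (A : formula S) T (v : graph A) k x : fits A T ->
  place T v = inl (k, x) -> lab v = Bnd x.
Proof.
elim: A T v => [a|A IHA B IHB|A IHA B IHB|y A IHA|y A IHA] [z|[] L R] v //=.
- by case: z.
- by case/andP=> fA fB; case: v => v; [apply: IHA|apply: IHB].
- by case/andP=> fA fB; case: v => v; [apply: IHA|apply: IHB].
- by case: L => // w /andP[_ fA]; case: v => [[] [_ ->]|v] //; apply: IHA.
- by case: L => // w /andP[_ fA]; case: v => [[] [_ ->]|v] //; apply: IHA.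
Qed.

(** * Scopes and kinds of the binders of a formula *)

Section Quantifiers.

Variables (S : signature) (A : formula S) (T : cotree).
Hypotheses (A_fits : fits A T) (T_uniq : uniq (leaves T)).

(** The second vertex in the scope is what makes the two kinds of binders exclusive. *)
Lemma place_scope (v : graph A) k x : place T v = inl (k, x) ->
  exists M, [/\ scope v M,
                forall u, u \in M -> u != v -> edge v u = k,
                exists2 u, u \in M & u != v &
                exists2 u, u \in M & literal u].
Proof.
move=> pv; have [X [vX mX mvX Xk [u uX lu]]] := binder_body A_fits pv.
have [|M [sM XM Mk]] := scope_binder vX _ mX mvX Xk; first by apply/set0Pn;
  exists u.
exists M; split=> //; exists u => //; try exact: (subsetP XM).
by apply: contraNneq vX => <-.
Qed.

Lemma existentialP (v : graph A) :
  existential v <-> exists x, place T v = inl (true, x).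
Proof.
split=> [[[x lv] [N sN adj]]|[x pv]].
  have [[] pv _] := place_binder A_fits lv; first by exists x.
  have [M [sM Mk [u uM uv] _]] := place_scope pv.
  by have := adj u; rewrite (scope_uniq sN sM) uM Mk // => /(_ isT uv).
split; first by exists x; apply: place_lab A_fits pv.
by have [M [sM Mk _ _]] := place_scope pv; exists M => // u uM uv; rewrite Mk.
Qed.

Lemma universalP (v : graph A) :
  universal v <-> exists x, place T v = inl (false, x).
Proof.
split=> [[[x lv] [N sN adj]]|[x pv]].
  have [[] pv _] := place_binder A_fits lv; last by exists x.
  have [M [sM Mk [u uM uv] _]] := place_scope pv.
  by have := adj u; rewrite (scope_uniq sN sM) uM Mk // => /(_ isT uv).
split; first by exists x; apply: place_lab A_fits pv.
by have [M [sM Mk _ _]] := place_scope pv; exists M => // u uM uv; rewrite Mk.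
Qed.

Lemma lab_binder_inj (v w : graph A) x : uniq (bound_vars A) ->
  lab v = Bnd x -> lab w = Bnd x -> v = w.
Proof.
rewrite -(perm_uniq (perm_qvars A)) cat_uniq => /and3P[_ /hasPn dis _] lv lw.
have [k pv xv] := place_binder A_fits lv;
  have [l pw xw] := place_binder A_fits lw.
apply: (place_inj A_fits T_uniq); rewrite pv pw.
case: k l xv xw {pv pw} => [] [] // xv xw.
  by have := dis x xw; rewrite /= xv.
by have := dis x xv; rewrite /= xw.
Qed.

Lemma graph_fograph : uniq (bound_vars A) -> fograph (graph A).
Proof.
move=> uA; split; [exact: graph_cograph|exact: graph_literal|move=> v x lv].
have [k pv _] := place_binder A_fits lv.
have [M [sM _ _ ML]] := place_scope pv; exists M => //; split=> // w _ /eqP wv.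
by rewrite lv => lw; apply: wv; apply: lab_binder_inj lw lv.
Qed.

End Quantifiers.

(** * From the forest of a sequent to the cotree of its disjunction *)

Section Sequents.

Variable S : signature.
Implicit Types (G : seq (formula S)) (F : seq cotree).

Fixpoint cotree_disj F : cotree :=
  if F is T :: F' then
    if F' is [::] then T else Join false T (cotree_disj F')
  else no_cotree.

Lemma deriv_neq0 G : deriv G -> G <> [::].
Proof.
elim=> {G} //.
- by move=> [|A G] [|B D].
- by move=> s [|A G] // ps _ _; case: s ps => // /perm_size.
Qed.

Lemma cotree_disj_pointwise (Q : formula S -> cotree -> Prop) G F :
    (forall A B L R, Q A L -> Q B R -> Q (Or A B) (Join false L R)) ->
    G <> [::] -> pointwise Q G F ->
  Q (disj G) (cotree_disj F).
Proof.
move=> QOr; elim: G F => // A [|B G] IH F _ /pointwise_inv[T [F' [-> QA]]].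
  by case: F' => [|? ?] [].
move=> QF; have [R [E [EF _ _]]] := pointwise_inv QF.
by rewrite EF in QF *; apply: QOr; last exact: (IH (R :: E)).
Qed.

Lemma leaves_cotree_disj F : F <> [::] -> leaves (cotree_disj F) = cleaves F.
Proof.
elim: F => // T [|R F] IH _; first by rewrite /cleaves /= cats0.
by rewrite cleaves_cons -IH.
Qed.

Lemma cedge_cotree_disj F u v : cedge (cotree_disj F) u v = fedge F u v.
Proof.
elim: F => // T [|R F] IH; first by rewrite /fedge /= orbF.
by rewrite fedge_cons -IH /= orbF.
Qed.

Lemma origins_cotree_disj F :
  cotree_origins (cotree_disj F) = flatten [seq cotree_origins T | T <- F].
Proof. by elim: F => // T [|R F] IH; [rewrite /= cats0|rewrite /= IH]. Qed.

Lemma bound_vars_disj G : bound_vars (disj G) = bvs G.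
Proof.
by elim: G => // A [|B G] IH; [rewrite /bvs /= cats0|rewrite /bvs /= IH].
Qed.

Lemma qvars_disj k G : qvars k (disj G) = qvs k G.
Proof.
by elim: G => // A [|B G] IH; [rewrite /qvs /= cats0|rewrite /qvs /= IH].
Qed.

Lemma fls_free_disj G : G <> [::] -> all (@fls_free S) G -> fls_free (disj G).
Proof.
by elim: G => // A [|B G] IH _ /= /andP[fA fG] //; rewrite fA; apply: IH.
Qed.

End Sequents.

Lemma graph_fls_free S (A : formula S) (v : graph A) :
  fls_free A -> lab v <> Lit Fls.
Proof.
elim: A v => [[]|A IHA B IHB|A IHA B IHB|y A IHA|y A IHA] //=.
- by move=> [v|v] /andP[fA fB]; [apply: IHA|apply: IHB].
- by move=> [v|v] /andP[fA fB]; [apply: IHA|apply: IHB].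
- by move=> [[]|v] //; apply: IHA.
- by move=> [[]|v] //; apply: IHA.
Qed.

(** * The fonet of a proof *)

Section ProofNet.

Variables (S : signature) (G : seq (formula S)) (P : deriv G).
Hypotheses (G_rect : rectified G) (G_fls : all (@fls_free S) G).

Let T := cotree_disj (trees P [::]).
Let G_neq0 : G <> [::] := deriv_neq0 P.

Lemma uniq_bvs : uniq (bvs G).
Proof. by have /andP[] := G_rect; rewrite bound_vars_disj. Qed.

Lemma bound_not_free x : x \in bvs G -> ~~ free x (disj G).
Proof. by have /andP[_ /allP] := G_rect; rewrite bound_vars_disj; apply. Qed.

Lemma proof_fits : fits (disj G) T.
Proof.
apply: (@cotree_disj_pointwise _ (fun A R => fits A R)) => //.
  by move=> A B L R /= -> ->.
exact: trees_fits.
Qed.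

Lemma proof_leaves : leaves T = cleaves (trees P [::]).
Proof.
apply: leaves_cotree_disj => F0; have := (trees_fits P [::]).1.
by rewrite F0; case: (G) G_neq0.
Qed.

Lemma proof_leaves_uniq : uniq (leaves T).
Proof. by rewrite proof_leaves; apply: trees_uniq uniq_bvs. Qed.

Lemma vertex_originE (v : sequent_graph G) :
  vertex_origin P v = node_origin (place T v).
Proof.
by rewrite -place_origin ?proof_fits // /T origins_cotree_disj -origins_trees.
Qed.

Lemma proof_place_inj : injective (@place S (disj G) T).
Proof. exact: place_inj proof_fits proof_leaves_uniq. Qed.

Lemma proof_link_place (v w : sequent_graph G) : v != w -> proof_link P v w ->
  exists q b, place T v = inr (q, Some b) /\ place T w = inr (q, Some (~~ b)).
Proof.
move=> vw; rewrite /proof_link !vertex_originE.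
have pvw : place T v <> place T w by move/proof_place_inj/eqP;
  rewrite (negPf vw).
case: (place T v) pvw => [//|[q [b|//]]];
  case: (place T w) => [//|[q' [b'|//]]] /=.
move=> neq /eqP [qq]; subst q'; exists q, b; split=> //.
by case: b b' neq => [] [].
Qed.

(** * The dualizer obtained from a renaming *)

Section Dualizer.

Variable r : subst S.
Hypothesis r_free : forall x, free x (disj G) -> r x = Var x.

Let d := lookup (renamed_instances P r).
Let kappa q := renamed_axiom P r (rev q).

Lemma dualizer_agrees : agrees d (renamed_instances P r).
Proof.
apply: agrees_lookup; rewrite (perm_uniq (renamed_instances_dom P r)).
have := uniq_bvs; rewrite -(perm_uniq (perm_qvs G)) cat_uniq.
by case/and3P.
Qed.

Lemma dualizer_rigid x : x \notin qvs true G -> d x = Var x.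
Proof.
move=> xG; apply: lookup_notin.
by rewrite (perm_mem (renamed_instances_dom P r)).
Qed.

Lemma dualizer_universal x : x \in qvs false G -> d x = Var x.
Proof.
move=> xG; apply: dualizer_rigid.
have := uniq_bvs; rewrite -(perm_uniq (perm_qvs G)) cat_uniq =>
  /and3P[_ /hasPn dis _].
exact: dis.
Qed.

(** In a rectified sequent no free variable is in the domain of [d], so [r] and [d] both fix the
    free variables. *)
Lemma dualizer_literal (v : sequent_graph G) a : lab v = Lit a ->
  exists2 p, place T v = inr p & leaf_atom kappa p = subst_atom d a.
Proof.
apply: (@place_literal _ _ _ _ _ d kappa r proof_fits).
- apply: cotree_disj_pointwise => //; apply: trees_realize => //.
    exact: dualizer_agrees.
  by move=> l; rewrite cats0.
- move=> z zG; rewrite r_free // dualizer_rigid //.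
  by apply: contraL zG => /qvs_bvs; apply: bound_not_free.
- by move=> y; rewrite qvars_disj; apply: dualizer_universal.
Qed.

Lemma renamed_dualizer : dualizer (proof_link P) d.
Proof.
split=> [x nx|v w a b vw lvw lv lw].
  apply: dualizer_rigid; apply/negP => xG.
  have [v pv] : exists v : graph (disj G), place T v = inl (true, x).
    by apply: place_onto proof_fits _;
      rewrite (fits_binder _ _ proof_fits) qvars_disj.
  apply: (nx v); first exact: place_lab proof_fits pv.
  by apply/(existentialP proof_fits); exists x.
have [q [c [pv pw]]] := proof_link_place vw lvw.
have [p] := dualizer_literal lv; rewrite pv => -[<-] <-.
have [p'] := dualizer_literal lw; rewrite pw => -[<-] <- /=.
by case: (c); rewrite //= dualK.
Qed.

Lemma proof_linked_fograph : linked_fograph (proof_link P).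
Proof.
split.
- apply: graph_fograph proof_fits proof_leaves_uniq _.
  by rewrite bound_vars_disj uniq_bvs.
- split; first by move=> v w; apply/andP/andP => -[n /eqP E]; rewrite -E eqxx.
  move=> w v u; rewrite /proof_link => /andP[v0 /eqP vw] /andP[_ /eqP wu].
  by rewrite v0 vw wu /=.
- move=> v vv; have : vertex_origin P v != None by case/andP: vv.
  rewrite vertex_originE; case pv: (place T v) => [//|[q [b|//]]] _.
  have [w pw] : exists w : graph (disj G), place T w = inr (q, Some (~~ b)).
    apply: place_onto proof_fits _; rewrite proof_leaves; apply: trees_partner.
    by rewrite -proof_leaves -pv; apply: place_leaves proof_fits.
  have vw : v != w by apply/eqP => vw; move: pw; rewrite -vw pv; case: (b).
  have lvu u : proof_link P v u = (u \in [set v; w]).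
    rewrite /proof_link !vertex_originE pv /= !inE; apply/eqP/orP.
      case pu: (place T u) => [//|[q' [b'|//]]] /= [qq]; subst q'.
      have [bb|bb] := eqVneq b' b; [left|right]; apply/eqP/proof_place_inj.
        by rewrite pu pv bb.
      by rewrite pu pw; case: (b) (b') bb => [] [].
    by case=> /eqP ->; rewrite ?pv ?pw.
  have isLit (u : sequent_graph G) p : place T u = inr p ->
    exists a, lab u = Lit a.
    move=> pu; case lu: (lab u) => [a|x]; first by exists a.
    by have [k] := place_binder proof_fits lu; rewrite pu.
  have [[a lv] [b' lw]] := (isLit _ _ pv, isLit _ _ pw).
  exists w, a, b'; split=> //.
  have fG := fls_free_disj G_neq0 G_fls.
  (* Linked atoms are dual under the dualizer [d]; without [Fls] they are pre-dual already. *)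
  apply: (@pre_dual_subst _ d); [| |apply: renamed_dualizer.2 vw _ lv lw].
  + by move=> a0; apply: (graph_fls_free (v := v) fG); rewrite lv a0.
  + by move=> b0; apply: (graph_fls_free (v := w) fG); rewrite lw b0.
  + by rewrite lvu !inE eqxx orbT.
- move=> v a lv; have [[q [b|]] pv] := dualizer_literal lv; last first.
    by case: (a) => //; left.
  by right; rewrite /proof_link vertex_originE pv /= eqxx.
Qed.

End Dualizer.

Lemma delta_renamed : delta P = lookup (renamed_instances P Var).
Proof. by rewrite renamed_instancesE. Qed.

Definition fresh : var := (\max_(x <- bvs G) x).+1.

(* Renaming every universally bound variable of the conclusion to a fresh one
   leaves in the instances only those universal variables that are
   introduced below. *)
Definition rename : subst S :=
  fun x => if x \in qvs false G then Var fresh else Var x.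

Lemma rename_free x : free x (disj G) -> rename x = Var x.
Proof.
rewrite /rename; case: ifP => // /qvs_bvs /bound_not_free /negPf -> //.
Qed.

Lemma rename_avoids y u : y \in qvs false G -> ~~ occurs_term y (rename u).
Proof.
move=> yG; rewrite /rename; case: ifP => [_|uG] /=; last first.
  by apply: contraFneq uG => <-.
apply/eqP => yf; have := qvs_bvs yG;
  rewrite yf => /(@leq_bigmax_seq _ _ xpredT id) /(_ isT).
by rewrite ltnn.
Qed.

Let d := lookup (renamed_instances P rename).

Lemma dependency_leap_id (v w : sequent_graph G) : dependency (proof_link P) v
  w ->
  leap_id d (place T v) (place T w).
Proof.
case=> /(existentialP proof_fits) [x pv] [/(universalP proof_fits) [y pw]].
case=> x' [y' [d' [lv lw [[d'rigid _] d'mg] yx]]].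
have xx : x' = x by have [k] := place_binder proof_fits lv; rewrite pv => -[].
have yy : y' = y by have [k] := place_binder proof_fits lw; rewrite pw => -[].
subst x' y'; rewrite pv pw /=.
(* The renamed dualizer is [s] after [d']. Both fix [y], whose only binder is universal, so [s]
   fixes [y] too and [y] survives in the renamed witness of [x]. *)
have [s sd'] := d'mg _ (renamed_dualizer rename_free).
have d'y : d' y = Var y.
  apply: d'rigid => u lu /(existentialP proof_fits) [z].
  rewrite (_ : u = w) ?pw //.
  apply: (lab_binder_inj proof_fits proof_leaves_uniq _ lu lw).
  by rewrite bound_vars_disj uniq_bvs.
have sy : s y = Var y.
  have := sd' y; rewrite d'y /= => <-; apply: dualizer_universal.
  rewrite -qvars_disj -(fits_binder _ _ proof_fits) -pw.
  exact: place_leaves proof_fits.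
by rewrite /d sd'; apply/occurs_subst_term; exists y => //; rewrite sy /=.
Qed.

Lemma leap_leap_id (v w : sequent_graph G) : leap (proof_link P) v w ->
  leap_id d (place T v) (place T w).
Proof.
case=> [[vw lvw]|[|]].
- by have [q [b [-> ->]]] := proof_link_place vw lvw; rewrite /= eqxx.
- exact: dependency_leap_id.
- by move/dependency_leap_id; rewrite leap_id_sym.
Qed.

Lemma proof_no_bimatching : ~ exists W, induces_bimatching (proof_link P) W.
Proof.
case=> W [[/set0Pn[v vW] mE] [_ mL]].
have inj := proof_place_inj; pose pl := @place S (disj G) T.
have memW u : (pl u \in [seq pl w | w <- enum W]) = (u \in W).
  by rewrite (mem_map inj) mem_enum.
(* The leaps carried over to names; of [leap_id d] only the inclusion is required. *)
pose e a b := exists v w : sequent_graph G,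
  [/\ pl v = a, pl w = b & leap (proof_link P) v w].
have plW a : a \in [seq pl w | w <- enum W] -> exists2 w, w \in W & a = pl w.
  by case/mapP => w; rewrite mem_enum; exists w.
have : [seq pl w | w <- enum W] = [::].
  apply: (@trees_no_bimatching S G P rename d [::] G_fls uniq_bvs
    (fun y u => @rename_avoids y u) (dualizer_agrees rename) e).
  - by rewrite map_inj_uniq ?enum_uniq.
  - move=> a /plW[w _ ->]; rewrite -proof_leaves.
    exact: place_leaves proof_fits.
  - move=> a b [u [w [<- <- uw]]]; exists w, u; split=> //.
    case: uw => [[uw luw]|[dep|dep]]; [left|by right; right|by right; left].
    have [_ [sym _] _ _] := proof_linked_fograph rename_free.
    by rewrite eq_sym uw sym.
  - move=> a [u [w [<- /inj <- uu]]];
    suff nodep : ~ dependency (proof_link P) w w.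
      by case: uu => [[/eqP neq _]|[]//]; case: neq.
    by case=> /(existentialP proof_fits)[x pu] [/(universalP proof_fits)[y]];
      rewrite pu.
  - by move=> a b [u [w [<- <- /leap_leap_id]]].
  - move=> a /plW[u uW ->]; have [w [[wW uw] wP]] := mE u uW.
    have edgeE u1 w1 : fedge (trees P [::]) (pl u1) (pl w1) = edge u1 w1.
      by rewrite (place_edge _ _ proof_fits proof_leaves_uniq)
        cedge_cotree_disj.
    exists (pl w); split; rewrite ?memW ?edgeE // => b /plW[z zW ->].
    by rewrite edgeE => uz; rewrite (wP z).
  - move=> a /plW[u uW ->]; have [w [[wW uw] wP]] := mL u uW.
    exists (pl w); split; rewrite ?memW //; first by exists u, w.
    move=> b /plW[z zW ->] [u1 [z1 [/inj -> /inj -> uz]]].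
    by rewrite (wP z).
by move/eqP; rewrite -size_eq0 size_map -cardE cards_eq0 => /eqP W0;
  rewrite W0 inE in vW.
Qed.

End ProofNet.
Theorem theorem8p1 :
  forall (S : signature) (Gamma : seq (formula S)) (Pi : deriv Gamma),
    rectified Gamma ->
    all (@fls_free S) Gamma ->
    @fonet S (sequent_graph Gamma) (proof_link Pi) /\
    @dualizer S (sequent_graph Gamma) (proof_link Pi) (delta Pi).
Proof.
move=> S Gamma Pi rect fls.
have dual_delta : dualizer (proof_link Pi) (delta Pi).
  (* [delta] is the case of the identity renaming. *)
  by rewrite delta_renamed; apply: renamed_dualizer.
split=> //; split; last exact: proof_no_bimatching.
  exact: (@proof_linked_fograph _ _ Pi rect fls Var).
by exists (delta Pi).
Qed.
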